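(* Let $I=\langle x^{a_i}y^{b_i}\mid 0\le i\le r\rangle$ be a monomial ideal of $R$ with $r\ge 2$, $a_0>a_1>\dots>a_{r-1}>a_r=0$, $b_0=0<b_1<\dots<b_{r-1}<b_r$ and $a_0\le b_r$. Let $M=M(I;r)$. Suppose that $I(M)$ is complete. Assume further that $x^{r-1}y\notin I(M)$ and $x^r\in I(M)$. Then $M$ is an indecomposable integrally closed $R$-module.
   Context: $(R,\mathfrak m)$ is a two-dimensional regular local ring with infinite residue field, and $x,y$ is a fixed regular system of parameters, $\mathfrak m=\langle x,y\rangle$. An ideal is complete if it is integrally closed. The module $M(I;e)$: for $I$ as in the claim and $2\le e\le r$ (here $e=r$), put $a_i'=a_i-e+1$ for $0\le i\le r-e+1$ and $c_i=b_{r-e+1+i}-i$ for $1\le i\le e-1$. Let $\epsilon_1,\dots,\epsilon_e$ be the standard basis of $R^e$. Then $M(I;e)\subset F:=R^e$ is the submodule generated by $f_i=x^{a_i'}y^{b_i}\epsilon_1$ for $0\le i\le r-e+1$, $g_i=y\,\epsilon_i+x\,\epsilon_{i+1}$ for $1\le i\le e-1$, $h_i=y^{c_i}\epsilon_{i+1}$ for $1\le i\le e-1$. For a finitely generated torsion-free $R$-module $M$, the double dual $M^{**}$ is free and contains $M$ with finite-length quotient; $I(M)=\operatorname{Fitt}_0(M^{**}/M)$. (For $M=M(I;e)$ one has $M^{**}=R^e$, so $I(M)$ is the ideal generated by the maximal minors of the matrix whose columns are $f_0,\dots,f_{r-e+1},g_1,\dots,g_{e-1},h_1,\dots,h_{e-1}$.)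 Integral closure of modules (Rees): with $K$ the fraction field of $R$, $M_K=M\otimes_R K$, and $MV$ the image of $M\otimes_R V\to M_K$ for $R\subset V\subset K$, set $\overline M=\{f\in M_K\mid f\in MV$ for every discrete valuation ring $V$ with $R\subset V\subset K\}$; $M$ is integrally closed if $\overline M=M$. *)

(* Defs.v *)
From HB Require Import structures.
From mathcomp Require Import all_boot all_order all_algebra.
From mathcomp Require Import ring_quotient.
From mathcomp Require Import boolp classical_sets cardinality.

Set Implicit Arguments.
Unset Strict Implicit.
Unset Printing Implicit Defensive.

Import Order.TTheory GRing.Theory Num.Theory.
Local Open Scope classical_set_scope.
Local Open Scope ring_scope.

(* Linear combinations of elements of X with coefficients in A.  Taking for A
   all of S gives the S-submodule generated by X; taking for A a subring of S
   gives the A-submodule generated by X. *)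
Definition lspan (S : pzRingType) (V : lmodType S) (A : set S) (X : set V) :
    set V :=
  [set v | exists (k : nat) (c : 'I_k -> S) (u : 'I_k -> V),
    [/\ forall i, A (c i), forall i, X (u i) & v = \sum_(i < k) c i *: u i]].

Definition ideal_gen (R : comNzRingType) (X : set R) : set R :=
  lspan [set: R] (X : set R^o).

Section RegularLocal.
Variable R : comNzRingType.

(* In the library, idealr_closed requires the ideal to be proper. *)
Definition prime_ideal (P : set R) : Prop :=
  idealr_closed [in P] /\ prime_idealr_closed [in P].

Definition maximal_ideal (J : set R) : Prop :=
  idealr_closed [in J] /\
  forall J' : set R, idealr_closed [in J'] -> J `<=` J' -> J' = J.

Definition local_ring (m : set R) : Prop :=
  maximal_ideal m /\ forall J : set R, maximal_ideal J -> J = m.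

Definition noetherian : Prop :=
  forall J : set R, @submod_closed R R^o [in J] ->
    exists2 S : set R, finite_set S & J = ideal_gen S.

Definition prime_chain (d : nat) (P : nat -> set R) : Prop :=
  (forall i, (i <= d)%N -> prime_ideal (P i)) /\
  (forall i, (i < d)%N -> P i `<` P i.+1).

Definition krull_dim (d : nat) : Prop :=
  (exists P, prime_chain d P) /\ ~ (exists P, prime_chain d.+1 P).

(* m is the maximal ideal; a system of d generators of m, d being the
   dimension, is what makes the local ring regular. *)
Definition regular_local2 (m : set R) (x y : R) : Prop :=
  [/\ noetherian, local_ring m, krull_dim 2 & m = ideal_gen [set x; y]].

(* The underlying set of R/J, as a set of cosets. *)
Definition cosets (J : set R) : set (set R) :=
  range (fun w : R => [set z | J (z - w)]).

Definition ideal_pow (J : set R) (n : nat) : set R :=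
  ideal_gen [set z | exists2 u : 'I_n -> R,
                       (forall i, J (u i)) & z = \prod_(i < n) u i].

Definition integral_over_ideal (J : set R) (z : R) : Prop :=
  exists (n : nat) (c : nat -> R),
    [/\ (0 < n)%N,
        forall i, (1 <= i <= n)%N -> ideal_pow J i (c i)
      & z ^+ n + \sum_(1 <= i < n.+1) c i * z ^+ (n - i) = 0].

Definition complete_ideal (J : set R) : Prop :=
  forall z, integral_over_ideal J z -> J z.

(* M is a submodule of R^n. *)
Definition indecomposable (n : nat) (M : set 'rV[R]_n) : Prop :=
  M <> [set 0] /\
  forall A B : set 'rV[R]_n, submod_closed [in A] -> submod_closed [in B] ->
    M = [set u + v | u in A & v in B] -> A `&` B = [set 0] ->
    A = [set 0] \/ B = [set 0].

End RegularLocal.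

Section DVR.
Variable K : fieldType.

(* The value of v at 0 is irrelevant. *)
Definition discrete_valuation (v : K -> int) : Prop :=
  [/\ forall z w : K, z != 0 -> w != 0 -> v (z * w) = v z + v w,
      forall z w : K, z != 0 -> w != 0 -> z + w != 0 ->
        Num.min (v z) (v w) <= v (z + w)
    & forall k : int, exists2 z : K, z != 0 & v z = k].

Definition dvr (V : set K) : Prop :=
  exists2 v : K -> int,
    discrete_valuation v & V = [set z | z = 0 \/ 0 <= v z].

End DVR.

(* Finitely generated torsion-free R-modules are handled as submodules M of
   some R^n, so that M_K = M (x)_R K is the K-span of M in K^n, and M, M** and
   the integral closure of M are all R-submodules of M_K. *)
Section TorsionFree.
Variable R : idomainType.
Local Notation K := {fraction R}.
Local Notation "s %:F" := (FracField.tofrac s).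

Definition fracR : set K := range (fun s : R => s%:F).

Definition frac_emb (n : nat) (M : set 'rV[R]_n) : set 'rV[K]_n :=
  [set map_mx (fun s : R => s%:F) v | v in M].

Definition frac_span (n : nat) (M : set 'rV[R]_n) : set 'rV[K]_n :=
  lspan [set: K] (frac_emb M).

Definition integral_closure (n : nat) (M : set 'rV[R]_n) : set 'rV[K]_n :=
  [set f | frac_span M f /\
     forall V : set K, dvr V -> fracR `<=` V -> lspan V (frac_emb M) f].

Definition integrally_closed (n : nat) (M : set 'rV[R]_n) : Prop :=
  integral_closure M = frac_emb M.

(* M* = Hom_R(M, R) consists of the K-linear forms on M_K mapping M into R;
   each is the restriction of a K-linear form on K^n.  In the same way M**
   consists of the elements of M_K at which M* takes values in R. *)
Definition dual_form (n : nat) (M : set 'rV[R]_n)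
    (phi : {linear 'rV[K]_n -> K^o}) : Prop :=
  forall v, frac_emb M v -> fracR (phi v).

Definition double_dual (n : nat) (M : set 'rV[R]_n) : set 'rV[K]_n :=
  [set v | frac_span M v /\
     forall phi : {linear 'rV[K]_n -> K^o}, dual_form M phi -> fracR (phi v)].

(* The zeroth Fitting ideal of P/Q, for R-submodules Q of P in K^n: p is a
   finite family generating P modulo Q, the rows of A are relations between
   the classes of the p j, and the ideal of the k x k minors of the matrix of
   all relations does not depend on p. *)
Definition Fitt0 (n : nat) (P Q : set 'rV[K]_n) : set R :=
  [set z | exists (k : nat) (p : 'I_k -> 'rV[K]_n),
    [/\ forall j, P (p j),
        forall v, P v -> exists c : 'I_k -> R,
          Q (v - \sum_(j < k) (c j)%:F *: p j)
      & ideal_gen [set \det A | A in [set A : 'M[R]_k |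
          forall i, Q (\sum_(j < k) (A i j)%:F *: p j)]] z]].

Definition ideal_of_module (n : nat) (M : set 'rV[R]_n) : set R :=
  Fitt0 (double_dual M) (frac_emb M).

End TorsionFree.

Section ModuleMIe.
Variables (R : comNzRingType) (x y : R) (r : nat) (a b : nat -> nat) (e : nat).

(* The standard basis of R^e, numbered from 1 to e. *)
Definition eps (i : nat) : 'rV[R]_e := \row_(j < e) (j.+1 == i)%:R.

(* The exponent a i + 1 - e is a i - e + 1, written so that truncated
   subtraction does no harm when a i = e - 1. *)
Definition genf (i : nat) : 'rV[R]_e :=
  (x ^+ (a i + 1 - e) * y ^+ b i) *: eps 1.
Definition geng (i : nat) : 'rV[R]_e := y *: eps i + x *: eps i.+1.
Definition genh (i : nat) : 'rV[R]_e :=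
  y ^+ (b (r - e + 1 + i) - i) *: eps i.+1.

Definition module_MIe : set 'rV[R]_e :=
  lspan [set: R]
    ([set genf i | i in [set i | (0 <= i <= r - e + 1)%N]] `|`
     [set geng i | i in [set i | (1 <= i <= e - 1)%N]] `|`
     [set genh i | i in [set i | (1 <= i <= e - 1)%N]]).

End ModuleMIe.

Arguments module_MIe {R} x y r a b e _.

(* Main.v *)
Require Import Defs.
From HB Require Import structures.
From mathcomp Require Import all_boot all_order all_algebra.
From mathcomp Require Import boolp classical_sets cardinality.
From mathcomp Require Import zify ring lra.

Set Implicit Arguments.
Unset Strict Implicit.
Unset Printing Implicit Defensive.

Import Order.TTheory GRing.Theory Num.Theory.
Local Open Scope classical_set_scope.
Local Open Scope ring_scope.

(** Write r = n + 1, F = R^r, M = M(I; r), and let phi : F -> R be the linear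
    form with coefficients (-1)^i x^(n-i) y^i, 0 <= i <= n.  Its kernel is
    generated by g_1, ..., g_n, and up to sign it maps f_0, f_1 and the h_i to
    the monomials x^(a 0), x^(a 1) y^(b 1) and x^(r-t) y^(b t), 2 <= t <= r.
    So M = phi^-1(I'), where I' = phi(M) is the ideal of these monomials
    ([module_MIe_preimage]), and questions about M become questions about
    monomials.

    The ideal I(M).  As M contains x^N F and y^N F, its double dual is F, and
    I(M) is generated by the determinants of the matrices with rows in M.  On
    the one hand phi(u) is the determinant with rows u, g_1, ..., g_n, so I' is
    contained in I(M).  On the other hand Cramer's rule gives
    x^(n-l) y^l det N in I' m^n for every matrix N with rows in M
    ([minor_form_multiple_of_det]).  With l = 0 the assumption x^r in I(M) forces
    a 0 = r, hence a i = r - i and I' = I; with l = n it follows that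
    I(M) = I, because (I m^n : y^n) = I ([ideal_of_moduleE]).  So I is complete.
    Finally x^(r-1) y not in I gives b 1 >= 2.

    M is integrally closed.  R is the intersection of the discrete valuation
    rings attached to its prime elements ([regular_normal]), so an element f of
    the integral closure is in F, and phi(f) is in I V for every discrete
    valuation ring V containing R.  Completeness of I makes its set of exponents
    convex, so every monomial outside I is separated from I by a weight, that
    is, by a monomial valuation.  Hence phi(f) is in I ([valuative_criterion])
    and f is in M.

    M is indecomposable.  A decomposition of M is given by an idempotent matrix
    P over R with M P contained in M ([projection_matrix]).  Since b 1 >= 2, I is
    contained in (x^r) + m^(r+1), and comparing the terms of degree r in
    phi(u P) for u = f_0, g_1, ..., g_n shows that modulo m the matrix P is lower
    triangular with constant diagonal.  The diagonal entry is 0 or 1 modulo m,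
    so one of 1 - P and P is invertible, and P is 0 or 1. *)

(** * Submodules and ideals *)

Section Submodules.
Variables (R : nzRingType) (V : lmodType R).
Implicit Types (M X : set V).

Definition is_submod M : Prop :=
  M 0 /\ forall c u v, M u -> M v -> M (c *: u + v).

Lemma submodD M u v : is_submod M -> M u -> M v -> M (u + v).
Proof. by move=> [_ h] hu hv; rewrite -[u]scale1r; exact: h. Qed.

Lemma submodZ M c u : is_submod M -> M u -> M (c *: u).
Proof. by move=> [h0 h] hu; rewrite -[_ *: _]addr0; exact: h. Qed.

Lemma submodB M u v : is_submod M -> M u -> M v -> M (u - v).
Proof.
by move=> hM hu hv; apply: submodD => //; rewrite -scaleN1r; apply: submodZ.
Qed.

Lemma submod_sum M (I : Type) (r : seq I) (P : pred I) (F : I -> V) :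
  is_submod M -> (forall i, P i -> M (F i)) -> M (\sum_(i <- r | P i) F i).
Proof.
move=> hM hF; elim/big_ind: _ => //; first by case: hM.
by move=> u v; exact: submodD.
Qed.

Lemma lspan_incl X : X `<=` lspan [set: R] X.
Proof. by move=> u hu; exists 1%N, (fun=> 1), (fun=> u); rewrite big_ord1 scale1r. Qed.

Lemma lspan_least X M : is_submod M -> X `<=` M -> lspan [set: R] X `<=` M.
Proof.
move=> hM XM _ [k [c [u [_ hu ->]]]]; apply: submod_sum => // i _.
by apply: submodZ => //; exact: XM.
Qed.

Lemma lspan_submod X : is_submod (lspan [set: R] X).
Proof.
split.
  by exists 0%N, (fun=> 0), (fun=> 0); split => //; [case|rewrite big_ord0].
move=> c _ _ [k [cu [eu [_ hu ->]]]] [l [cv [ev [_ hv ->]]]].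
exists (k + l)%N, (fun i => match split i with inl j => c * cu j | inr j => cv j end),
  (fun i => match split i with inl j => eu j | inr j => ev j end); split => //.
  by move=> i; case: (split i).
rewrite big_split_ord /= scaler_sumr; congr (_ + _).
  apply: eq_bigr => i _; case: splitP => [j /= e|j /= e].
    by rewrite (_ : j = i) ?scalerA //; exact: val_inj.
  by have := ltn_ord i; rewrite e; lia.
apply: eq_bigr => i _; case: splitP => [j /= e|j /= e].
  by have := ltn_ord j; rewrite -e; lia.
by rewrite (_ : j = i) //; apply: val_inj => /=; lia.
Qed.

Lemma submod_closedP M : GRing.submod_closed [in M] -> is_submod M.
Proof.
case=> h0 h; split; first exact/set_mem.
by move=> c u v hu hv; apply/set_mem/h; apply/mem_set.
Qed.

End Submodules.

(** The unit ideal is allowed, unlike for [idealr_closed]. *)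
Definition is_ideal (R : comNzRingType) (J : set R) : Prop :=
  J 0 /\ forall c u v, J u -> J v -> J (c * u + v).

Definition divides (R : comNzRingType) (t z : R) : Prop := exists c, z = c * t.

Definition ideal2 (R : comNzRingType) (s t z : R) : Prop :=
  exists c d, z = c * s + d * t.

Section Ideals.
Variable R : comNzRingType.
Implicit Types (J : set R) (s t z u v : R).

Lemma idealD J u v : is_ideal J -> J u -> J v -> J (u + v).
Proof. by move=> [_ h] hu hv; rewrite -[u]mul1r; exact: h. Qed.

Lemma idealM J c u : is_ideal J -> J u -> J (c * u).
Proof. by move=> [h0 h] hu; rewrite -[_ * _]addr0; exact: h. Qed.

Lemma idealB J u v : is_ideal J -> J u -> J v -> J (u - v).
Proof.
by move=> hJ hu hv; apply: idealD => //; rewrite -mulN1r; apply: idealM.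
Qed.

Lemma ideal_sum J (I : Type) (r : seq I) (P : pred I) (F : I -> R) :
  is_ideal J -> (forall i, P i -> J (F i)) -> J (\sum_(i <- r | P i) F i).
Proof.
move=> hJ hF; elim/big_ind: _ => //; first by case: hJ.
by move=> u v; exact: idealD.
Qed.

Lemma ideal2_ideal s t : is_ideal (ideal2 s t).
Proof.
split; first by exists 0, 0; rewrite !mul0r addr0.
move=> c u v [c1 [d1 ->]] [c2 [d2 ->]].
by exists (c * c1 + c2), (c * d1 + d2); ring.
Qed.

Lemma divides_ideal t : is_ideal (divides t).
Proof.
split; first by exists 0; rewrite mul0r.
by move=> c u v [c1 ->] [c2 ->]; exists (c * c1 + c2); ring.
Qed.

Lemma ideal2l s t c : ideal2 s t (c * s).
Proof. by exists c, 0; rewrite mul0r addr0. Qed.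

Lemma ideal2r s t c : ideal2 s t (c * t).
Proof. by exists 0, c; rewrite mul0r add0r. Qed.

Lemma ideal2_fst s t : ideal2 s t s.
Proof. by rewrite -{2}[s]mul1r; exact: ideal2l. Qed.

Lemma ideal2_snd s t : ideal2 s t t.
Proof. by rewrite -{2}[t]mul1r; exact: ideal2r. Qed.

Lemma ideal_genP (X : set R) z : ideal_gen X z <->
  forall J, is_ideal J -> X `<=` J -> J z.
Proof.
split=> [hz J JI XJ|h]; first exact: (@lspan_least R R^o X J JI XJ z hz).
by apply: h; [exact: (@lspan_submod R R^o X)|exact: (@lspan_incl R R^o X)].
Qed.

Lemma idealr_closedE J : idealr_closed [in J] <-> is_ideal J /\ ~ J 1.
Proof.
split.
  case=> h0 h1 h; split; last first.
    by move=> /mem_set; exact/negP.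
  split; first exact/set_mem.
  by move=> c u v hu hv; apply/set_mem/h; apply/mem_set.
case=> -[h0 h] h1; split; first exact/mem_set.
  by apply/negP => /set_mem.
by move=> c u v /set_mem hu /set_mem hv; apply/mem_set/h.
Qed.

Lemma submod_closedE J : is_ideal J -> @GRing.submod_closed R R^o [in J].
Proof.
case=> h0 h; split; first exact/mem_set.
by move=> c u v /set_mem hu /set_mem hv; apply/mem_set/h.
Qed.

End Ideals.

(** * Chain conditions and Krull's intersection theorem *)

Section Noetherian.
Variable R : comNzRingType.
Hypothesis noeR : noetherian R.

(** A family without a maximal member yields, by choice, a strictly increasing
    chain; but the union of the chain is finitely generated, so the chain stops
    at the stage that contains the generators. *)
Lemma noetherian_max (Phi : set (set R)) (J0 : set R) : Phi J0 ->
  (forall J, Phi J -> is_ideal J) ->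
  exists2 J, Phi J & forall J', Phi J' -> J `<=` J' -> J' `<=` J.
Proof.
move=> hJ0 hPhi; apply: contrapT => hno.
have step (J : {J | Phi J}) : exists J' : {J | Phi J},
    sval J `<=` sval J' /\ ~ (sval J' `<=` sval J).
  case: J => J hJ; apply: contrapT => hJ'; apply: hno; exists J => // J' h1 h2.
  by apply: contrapT => h3; apply: hJ'; exists (exist _ J' h1).
have [f hf] := choice step.
pose c n := sval (iter n f (exist _ J0 hJ0)).
have cI n : is_ideal (c n) by apply: hPhi; exact: svalP.
have cS n : c n `<=` c n.+1 by case: (hf (iter n f (exist _ J0 hJ0))).
have cm k n : (k <= n)%N -> c k `<=` c n.
  by move/subnK <-; elim: (n - k)%N => // l IH z /IH /cS.
pose U : set R := [set z | exists n, c n z].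
have hU : is_ideal U.
  split; first by exists 0%N; case: (cI 0%N).
  move=> d u v [k hu] [l hv]; exists (maxn k l); case: (cI (maxn k l)) => _; apply.
    exact: cm (leq_maxl _ _) _ hu.
  exact: cm (leq_maxr _ _) _ hv.
have [S /finite_seqP [s hs] eU] := noeR (submod_closedE hU).
have [N hN] : exists N, forall z, z \in s -> c N z.
  have : forall z, z \in s -> U z.
    move=> z zs; rewrite eU; apply/ideal_genP => J _; apply; by rewrite hs.
  elim: (s) => [|z l IH] h; first by exists 0%N.
  have [|N hN] := IH; first by move=> w wl; apply: h; rewrite inE wl orbT.
  have [k hk] := h z (mem_head _ _).
  exists (maxn k N) => w; rewrite inE => /orP [/eqP ->|/hN].
    exact: cm (leq_maxl _ _) _ hk.
  exact: cm (leq_maxr _ _) _.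
have [_ []] := hf (iter N f (exist _ J0 hJ0)).
move=> z hz; have : U z by exists N.+1.
by rewrite eU => /ideal_genP /(_ _ (cI N)); apply=> w; rewrite hs => /hN.
Qed.

Lemma noetherian_chain (c : nat -> set R) : (forall n, is_ideal (c n)) ->
  (forall n, c n `<=` c n.+1) -> exists N, forall n, (N <= n)%N -> c n `<=` c N.
Proof.
move=> cI cS.
have cm k n : (k <= n)%N -> c k `<=` c n.
  by move/subnK <-; elim: (n - k)%N => // l IH z /IH /cS.
have [||J [N _ <-] hN] := @noetherian_max (range c) (c 0%N).
- by exists 0%N.
- by move=> J [n _ <-].
by exists N => n Nn; apply: hN (cm _ _ Nn); exists n.
Qed.

End Noetherian.

Section Krull.
Variable R : idomainType.
Hypothesis noeR : noetherian R.

(** Krull's intersection theorem for the ideal generated by z in R/(t).  Write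
    w = f_n z^n modulo t.  The ideals ((t) : z^n) are eventually equal to some
    Q, and modulo Q one has f_n = f_(n+1) z.  The increasing ideals Q + (f_n) are
    also stationary, so that f_(n+1) = d f_n = d f_(n+1) z modulo Q; as 1 - d z
    is a unit, f_(n+1) is in Q. *)
Lemma krull_intersection (t z w : R) : (forall c, 1 - c * z \is a GRing.unit) ->
  (forall n, ideal2 t (z ^+ n) w) -> divides t w.
Proof.
move=> hz hw.
have /choice [f hf] : forall n, exists f, divides t (w - f * z ^+ n).
  by move=> n; have [c [f e]] := hw n; exists f, c; rewrite e addrK.
pose Q n : set R := [set c | divides t (c * z ^+ n)].
have QI n : is_ideal (Q n).
  split; first by rewrite /Q /= mul0r; case: (divides_ideal t).
  move=> c u v /= hu hv; rewrite /Q /= mulrDl -mulrA.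
  by case: (divides_ideal t) => _; apply.
have QS n : Q n `<=` Q n.+1.
  move=> c hc; rewrite /Q /= exprSr mulrA mulrC; exact: idealM (divides_ideal t) hc.
have [N hN] := noetherian_chain noeR QI QS.
have QN n : (N <= n)%N -> Q N (f n - f n.+1 * z).
  move=> Nn; apply: (hN n) => //; rewrite /Q /=.
  rewrite (_ : _ * _ = (w - f n.+1 * z ^+ n.+1) - (w - f n * z ^+ n)).
    by apply: (idealB (divides_ideal t)).
  by rewrite exprS; ring.
pose C k : set R := [set c | exists2 q, Q N q & exists d, c = q + d * f (N + k)%N].
have CI k : is_ideal (C k).
  split; first by exists 0; [case: (QI N)|exists 0; rewrite mul0r addr0].
  move=> c u v [q hq [d ->]] [q' hq' [d' ->]].
  exists (c * q + q'); first by case: (QI N) => _; apply.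
  by exists (c * d + d'); ring.
have CS k : C k `<=` C k.+1.
  move=> u [q hq [d ->]]; exists (q + d * (f (N + k)%N - f (N + k).+1 * z)).
    by apply: idealD => //; apply: idealM => //; apply: QN; lia.
  by exists (d * z); rewrite addnS; ring.
have [k hk] := noetherian_chain noeR CI CS.
have : C k (f (N + k).+1).
  apply: (hk k.+1) => //; exists 0; first by case: (QI N).
  by exists 1; rewrite addnS mul1r add0r.
case=> q hq [d e].
set g := f (N + k)%N in e; set g' := f (N + k).+1 in e.
have hg' : Q N g'.
  rewrite -(mulKr (hz d) g').
  apply: idealM => //.
  rewrite (_ : (1 - d * z) * g' = q + d * (g - g' * z)); last first.
    by rewrite mulrBl mul1r {1}e; ring.
  by apply: idealD => //; apply: idealM => //; apply: QN; lia.
have hQ : Q (N + k).+1 g'.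
  have mono n : Q N `<=` Q (N + n)%N by elim: n => [|n IH] u; rewrite ?addn0 // addnS => /IH /QS.
  by rewrite -addnS; apply: mono.
rewrite (_ : w = (w - g' * z ^+ (N + k).+1) + g' * z ^+ (N + k).+1); last by rewrite subrK.
by apply: (idealD (divides_ideal t)) => //; exact: hf (N + k).+1.
Qed.

End Krull.

(** * Regular local rings of dimension two *)

(** The consequences of two-dimensional regularity that the argument uses: x and
    y generate the maximal ideal and form a regular sequence. *)
Record regular_pair (R : idomainType) (x y : R) : Prop := RegularPair {
  rp_noeth : noetherian R;
  rp_unit : forall z, ~ ideal2 x y z -> z \is a GRing.unit;
  rp_proper : ~ ideal2 x y 1;
  rp_x0 : x != 0;
  rp_y0 : y != 0;
  rp_reg : forall u v, x * u = y * v -> divides x v }.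

Section RegularLocalRing.
Variables (R : idomainType) (x y : R).

Lemma ideal2C (s t z : R) : ideal2 s t z -> ideal2 t s z.
Proof. by case=> c [d ->]; exists d, c; rewrite addrC. Qed.

Lemma regular_pairC : regular_pair x y -> regular_pair y x.
Proof.
case=> h1 h2 h3 x0 y0 h6; split => //.
- by move=> z hz; apply: h2 => /ideal2C.
- by move=> /ideal2C.
- move=> u v e; have [w ew] := h6 _ _ (esym e).
  exists w; apply: (mulfI x0); rewrite -e ew; ring.
Qed.

Hypotheses (noeR : noetherian R)
  (unitR : forall z, ~ ideal2 x y z -> z \is a GRing.unit)
  (properR : ~ ideal2 x y 1).

Lemma unit_sub1 z c : ideal2 x y z -> 1 - c * z \is a GRing.unit.
Proof.
move=> hz; apply: unitR => h; apply: properR.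
rewrite (_ : 1 = (1 - c * z) + c * z); last by rewrite subrK.
by apply: idealD => //; [exact: ideal2_ideal|apply: idealM => //; exact: ideal2_ideal].
Qed.

Lemma nonunit z : z \is a GRing.unit -> ~ ideal2 x y z.
Proof.
move=> uz hz; apply: properR; rewrite -(mulVr uz).
by apply: idealM => //; exact: ideal2_ideal.
Qed.

(** By Krull's theorem there is a largest n with z in (x, y^n).  The coefficient
    of y^n is then a unit, because the maximal ideal is generated by x and y. *)
Lemma unit_times_power z : ~ divides x z ->
  exists k u w, u \is a GRing.unit /\ z = u * y ^+ k + w * x.
Proof.
move=> hz.
have [n hn] : exists n, ~ ideal2 x (y ^+ n) z.
  apply: contrapT => hno; apply: hz; apply: (krull_intersection noeR) => [c|n].
    by apply: unit_sub1; exact: ideal2_snd.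
  by apply: contrapT => h; apply: hno; exists n.
have h0 : ideal2 x (y ^+ 0) z by rewrite -[z]mulr1; exact: ideal2r.
elim: n hn => // n IH hn.
have [[c [u e]]|/IH //] := pselect (ideal2 x (y ^+ n) z).
exists n, u, c; split; last by rewrite e addrC.
apply: unitR => -[s [t eu]]; apply: hn; exists (c + s * y ^+ n), t.
by rewrite e eu exprS; ring.
Qed.

(** Every nonzero ideal of R/(x) is generated by a power of y.  A lift g of the
    generator of the image of P gives P = (g) + x P, since x p in P forces p in
    P.  Iterating, P is contained in (g) + (x^n) for all n. *)
Lemma prime_principal (P : set R) : is_ideal P ->
  (forall u v, P (u * v) -> P u \/ P v) -> ~ P x ->
  exists2 g, P g & forall p, P p -> divides g p.
Proof.
move=> PI Pp Px.
have [g Pg hg] : exists2 g, P g & forall p, P p -> exists2 q, P q & exists c, p = c * g + q * x.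
  have fin g : P g -> (forall p, P p -> exists c q, p = c * g + q * x) ->
      forall p, P p -> exists2 q, P q & exists c, p = c * g + q * x.
    move=> Pg h p Pp'; have [c [q e]] := h p Pp'; exists q; last by exists c.
    case: (Pp q x) => //; rewrite (_ : _ * _ = p - c * g); last by rewrite e; ring.
    by apply: idealB => //; apply: idealM.
  have [hP|hP] := pselect (forall p, P p -> divides x p).
    exists 0; first by case: PI.
    apply: fin => [|p /hP [q ->]]; first by case: PI.
    by exists 0, q; rewrite mul0r add0r.
  pose L k := `[< exists g u w, [/\ P g, u \is a GRing.unit & g = u * y ^+ k + w * x] >].
  have exL : exists k, L k.
    apply: contrapT => hno; apply: hP => p Pp'; apply: contrapT => /unit_times_power.
    by case=> k [u [w [uu e]]]; apply: hno; exists k; apply/asboolP; exists p, u, w.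
  case: (ex_minnP exL) => k /asboolP [g [u [w [Pg uu eg]]]] kmin.
  exists g => //; apply: fin => // p Pp'.
  have [[q ->]|] := pselect (divides x p); first by exists 0, q; rewrite mul0r add0r.
  case/unit_times_power => l [u' [w' [uu' ep]]].
  have kl : (k <= l)%N by apply: kmin; apply/asboolP; exists p, u', w'.
  exists (u' * u^-1 * y ^+ (l - k)), (w' - u' * u^-1 * y ^+ (l - k) * w).
  rewrite ep eg -{1}(subnK kl) exprD -[u' in LHS](divrK uu); ring.
exists g => // p Pp'.
apply: (krull_intersection noeR (z := x)) => [c|n].
  by apply: unit_sub1; exact: ideal2_fst.
have [q _ [c e]] : exists2 q, P q & exists c, p = c * g + q * x ^+ n.
  elim: n => [|n [q Pq [c ->]]]; first by exists p => //; exists 0; rewrite mul0r add0r mulr1.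
  have [q' Pq' [c' ->]] := hg q Pq; exists q' => //.
  by exists (c + c' * x ^+ n); rewrite exprS; ring.
by rewrite e; exists c, q.
Qed.

(** Dimension two enters through a prime P strictly between 0 and the maximal
    ideal.  If x is in P, then P = (x) is not maximal and contains no power of y.
    If not, P = (g); if x divided a power of y it would divide some g^n, and as
    the prime g does not divide x, cancelling g^n would make x a unit.  In both
    cases no power of y is in (x), and [unit_times_power] concludes. *)
Lemma regular_pair_intro (P : set R) : is_ideal P ->
  (forall u v, P (u * v) -> P u \/ P v) -> (exists2 p, P p & p != 0) ->
  P `<=` ideal2 x y -> ~ (ideal2 x y `<=` P) ->
  x != 0 /\ forall u v, x * u = y * v -> divides x v.
Proof.
move=> PI Pp [p0 Pp0 p00] Pm mP.
have main : x != 0 /\ forall n, ~ divides x (y ^+ n).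
  have [Px|Px] := pselect (P x).
    have Py : ~ P y.
      move=> Py; apply: mP => z [c [d ->]]; apply: idealD => //; exact: idealM.
    have hP : forall p, P p -> divides x p.
      move=> p Pp'; apply: contrapT => /unit_times_power [k [u [w [uu e]]]].
      have : P (y ^+ k).
        rewrite -[y ^+ k](mulKr uu); apply: idealM => //.
        rewrite (_ : _ * _ = p - w * x); last by rewrite e addrK.
        by apply: idealB => //; exact: idealM.
      elim: k {e} => [|k IH]; first by rewrite expr0 => /Pm /properR.
      by rewrite exprS => /Pp [|].
    split.
      apply/eqP => x0; have [c e] := hP _ Pp0; move: p00; rewrite e x0 mulr0 eqxx //.
    move=> n [c e]; have : P (y ^+ n) by rewrite e; exact: idealM.
    elim: n {e} => [|n IH]; first by rewrite expr0 => /Pm /properR.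
    by rewrite exprS => /Pp [|].
  split; first by apply/eqP => x0; apply: Px; rewrite x0; case: PI.
  move=> n [c e]; have [g Pg hg] := prime_principal PI Pp Px.
  have g0 : g != 0.
    apply/eqP => g0; have [d ed] := hg _ Pp0; move: p00.
    by rewrite ed g0 mulr0 eqxx.
  have [w ew] : divides x (g ^+ n).
    have [s [t eg]] := Pm _ Pg.
    have [w ->] : exists w, g ^+ n = w * x + t ^+ n * y ^+ n.
      rewrite eg; elim: (n) => [|k [w e']]; first by exists 0; rewrite mul0r add0r mul1r.
      rewrite exprSr e'; exists (w * (s * x + t * y) + t ^+ k * y ^+ k * s).
      by rewrite !exprSr; ring.
    by exists (w + t ^+ n * c); rewrite e; ring.
  have [w' ew'] : exists w', w = w' * g ^+ n.
    elim: (n) w ew => [|k IH] w ew; first by exists w; rewrite mulr1.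
    have : P (w * x) by rewrite -ew exprS mulrC; exact: idealM.
    case/Pp => // /hg [w1 ew1].
    have [|w2 ew2] := IH w1.
      by apply: (mulfI g0); rewrite -exprS ew ew1; ring.
    by exists w2; rewrite ew1 ew2 exprS; ring.
  have gn0 : g ^+ n != 0 by rewrite expf_neq0.
  apply: properR; exists w', 0; rewrite mul0r addr0; apply: (mulfI gn0).
  by rewrite mulr1 {1}ew ew'; ring.
case: main => x0 hy; split => // u v e.
apply: contrapT => /unit_times_power [k [a [w [ua ev]]]].
apply: (hy k.+1); exists (a^-1 * (u - y * w)); apply: (mulrI ua).
rewrite mulrA mulrA divrr // mul1r exprS; move: e; rewrite ev => e.
by rewrite mulrBl [u * x]mulrC e; ring.
Qed.

End RegularLocalRing.
Lemma regular_local2_pair (R : idomainType) (m : set R) (x y : R) :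
  regular_local2 m x y -> regular_pair x y.
Proof.
case=> noeR [mmax muniq] [[P [Ppr Plt]] _] em.
have mE z : m z <-> ideal2 x y z.
  rewrite em; split=> [/ideal_genP /(_ _ (ideal2_ideal x y))|[c [d ->]]].
    by apply=> w [] ->; [exact: ideal2_fst|exact: ideal2_snd].
  apply/ideal_genP => J JI XJ; apply: idealD => //; apply: idealM => //; apply: XJ.
    by left.
  by right.
have proper : ~ ideal2 x y 1 by move=> /mE; case: mmax => /idealr_closedE [].
have unit z : ~ ideal2 x y z -> z \is a GRing.unit.
  move=> hz; apply: contrapT => hu; apply: hz; apply/mE.
  have [||J [JI Jz J1] Jmax] := @noetherian_max R noeR
      [set J | [/\ is_ideal J, J z & ~ J 1]] (divides z).
  - split; [exact: divides_ideal|by exists 1; rewrite mul1r|].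
    by case=> c e; apply: hu; apply/unitrP; exists c; rewrite -e mulrC.
  - by move=> J [].
  have <- // : J = m; apply: muniq; split; first exact/idealr_closedE.
  move=> J' /idealr_closedE [J'I J'1] JJ'; apply/seteqP; split => //.
  by apply: Jmax => //; split => //; exact: JJ'.
have primeP i : (i <= 2)%N -> [/\ is_ideal (P i), ~ P i 1 &
    forall u v, P i (u * v) -> P i u \/ P i v].
  move=> /Ppr [/idealr_closedE [PI P1] Pp]; split => // u v /mem_set /Pp.
  by move=> /orP [/set_mem|/set_mem]; [left|right].
have subm i : (i <= 2)%N -> P i `<=` ideal2 x y.
  move=> /primeP [PI P1 _] z Pz; apply: contrapT => /unit uz; apply: P1.
  by rewrite -(mulVr uz); exact: idealM.
have [PI P1 Pp] := primeP 1%N isT.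
have P1S : exists2 p, P 1%N p & p != 0.
  have [_ /existsNP [p]] := Plt 0%N isT; move=> /not_implyP [Pp1 Pp0].
  by exists p => //; apply/eqP => p0; apply: Pp0; rewrite p0; case: (primeP 0%N isT) => -[].
have Pm : ~ (ideal2 x y `<=` P 1%N).
  have [_ hn] := Plt 1%N isT; move=> hm; apply: hn => z Pz.
  exact/hm/(subm 2%N).
have [x0 xy] := regular_pair_intro noeR unit proper PI Pp P1S (subm 1%N isT) Pm.
split => //; apply/eqP => y0; have [|c e] := xy 0 1; first by rewrite mulr0 y0 mul0r.
by apply: proper; rewrite e; exact: ideal2l.
Qed.

(** * Discrete valuations from filtrations *)

Section ValuationGe.
Variables (K : fieldType) (v : K -> int).
Hypothesis hv : discrete_valuation v.

(** For k = 0 this is the valuation ring of v, in the form used in [dvr]. *)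
Definition valuation_ge (k : int) : set K := [set z | z = 0 \/ k <= v z].

Lemma valuation_geD k z w :
  valuation_ge k z -> valuation_ge k w -> valuation_ge k (z + w).
Proof.
have [_ hD _] := hv.
have [->|z0] := eqVneq z 0; first by rewrite add0r.
have [->|w0] := eqVneq w 0; first by rewrite addr0.
case=> [/eqP|hz]; first by rewrite (negPf z0).
case=> [/eqP|hw]; first by rewrite (negPf w0).
have [->|s0] := eqVneq (z + w) 0; [by left|right].
by apply: le_trans (hD _ _ z0 w0 s0); rewrite le_min hz.
Qed.

Lemma valuation_geM k l z w :
  valuation_ge k z -> valuation_ge l w -> valuation_ge (k + l) (z * w).
Proof.
have [hM _ _] := hv.
have [->|z0] := eqVneq z 0; first by rewrite mul0r; left.
have [->|w0] := eqVneq w 0; first by rewrite mulr0; left.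
case=> [/eqP|hz]; first by rewrite (negPf z0).
case=> [/eqP|hw]; first by rewrite (negPf w0).
by right; rewrite hM //; exact: lerD.
Qed.

End ValuationGe.

Section Valuation.
Variable R : idomainType.
Local Notation K := {fraction R}.
Local Notation "s %:F" := (FracField.tofrac s).

Lemma frac_repr (k : K) : exists s t : R, t != 0 /\ k = s%:F / t%:F.
Proof.
elim/quotW: k => q; exists (frac q).1, (frac q).2; split; first exact: denom_ratioP.
have d0 : (frac q).2%:F != 0 by rewrite tofrac_eq0; exact: denom_ratioP.
apply: (mulIf d0); rewrite divfK //.
rewrite [(frac q).2%:F]piE [(frac q).1%:F]piE; rewrite -[LHS]FracField.pi_mul.
apply/eqmodP; rewrite /= FracField.equivfE /FracField.mulf /=.
by rewrite !numden_Ratio ?mulf_neq0 ?oner_eq0 ?denom_ratioP //= !mulr1 mulrC.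
Qed.

Lemma frac_eq (s t s' t' : R) : t != 0 -> t' != 0 ->
  s%:F / t%:F = s'%:F / t'%:F -> s * t' = s' * t.
Proof.
move=> t0 t'0 /eqP; rewrite eqr_div ?tofrac_eq0 // -!tofracM tofrac_eq => /eqP ->.
by [].
Qed.

(** A separated filtration whose graded ring is a domain comes from a valuation:
    the order of an element is the last index whose step contains it, and orders
    add up under products.  Two elements with consecutive orders make the
    valuation surjective. *)
Lemma filtration_valuation (J : nat -> set R) :
  (forall n, is_ideal (J n)) -> (forall z, J 0%N z) ->
  (forall n, J n.+1 `<=` J n) -> (forall z : R, z != 0 -> exists n, ~ J n z) ->
  (forall n k z w, J n z -> ~ J n.+1 z -> J k w -> ~ J k.+1 w ->
     J (n + k)%N (z * w) /\ ~ J (n + k).+1 (z * w)) ->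
  (exists z w n, [/\ J n.+1 z, ~ J n.+2 z, J n w & ~ J n.+1 w]) ->
  exists2 v : K -> int, discrete_valuation v &
    forall n z, J n z <-> valuation_ge v n z%:F.
Proof.
move=> JI J0 Jdec Jsep Jmul [z1 [z0 [n1 [hz1 hz1' hz0 hz0']]]].
have Jm k n : (k <= n)%N -> J n `<=` J k.
  by move/subnK <-; elim: (n - k)%N => // l IH z /Jdec /IH.
have Jn0 n : J n 0 by case: (JI n).
have /choice [ord hord] : forall z : R, exists n, z != 0 -> J n z /\ ~ J n.+1 z.
  move=> z.
  have [->|z0'] := eqVneq z 0; first by exists 0%N.
  have [n hn] := Jsep _ z0'; elim: n hn => [/(_ (J0 z)) //|n IH] hn.
  by have [hz|/IH //] := pselect (J n z); exists n.
have ordJ n (z : R) : z != 0 -> J n z <-> (n <= ord z)%N.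
  move=> zn0; have [h1 h2] := hord z zn0; split=> [hz|/Jm]; last exact.
  rewrite leqNgt; apply/negP => hlt; exact/h2/(Jm _ _ hlt).
have ordE n (z : R) : J n z -> ~ J n.+1 z -> ord z = n.
  move=> h1 h2; have zn0 : z != 0 by apply/eqP => z00; apply: h2; rewrite z00.
  have := (ordJ n z zn0).1 h1; rewrite leq_eqVlt => /orP [/eqP //|hlt].
  by case: h2; apply/ordJ.
have ordM (z w : R) : z != 0 -> w != 0 -> ord (z * w) = (ord z + ord w)%N.
  move=> zn0 wn0; have [h1 h2] := hord z zn0; have [h3 h4] := hord w wn0.
  by have [h5 h6] := Jmul _ _ _ _ h1 h2 h3 h4; exact: ordE.
have ordD (z w : R) n : z != 0 -> w != 0 -> z + w != 0 ->
    (n <= ord z)%N -> (n <= ord w)%N -> (n <= ord (z + w)%R)%N.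
  move=> zn0 wn0 s0 h1 h2; apply/ordJ => //; apply: idealD => //; exact/ordJ.
have /choice [v hv] : forall k : K, exists q : int, forall s t : R, s != 0 -> t != 0 ->
    k = s%:F / t%:F -> q = (ord s)%:Z - (ord t)%:Z.
  move=> k; have [s [t [t0 ek]]] := frac_repr k.
  exists ((ord s)%:Z - (ord t)%:Z) => s' t' s'0 t'0 ek'.
  have e := frac_eq t0 t'0 (etrans (esym ek) ek').
  have s0 : s != 0.
    by apply/eqP => s0; have /eqP := e; rewrite s0 mul0r eq_sym mulf_eq0 (negPf s'0) (negPf t0).
  have := ordM _ _ s0 t'0; rewrite e ordM //; lia.
have num0 s t : s%:F / t%:F != 0 :> K -> s != 0.
  by apply: contraNneq => ->; rewrite tofrac0 mul0r.
have vE s t : s != 0 -> t != 0 -> v (s%:F / t%:F) = (ord s)%:Z - (ord t)%:Z.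
  by move=> s0 t0; exact: hv.
have vM z w : z != 0 -> w != 0 -> v (z * w) = v z + v w.
  have [s [t [t0 ->]]] := frac_repr z; have [s' [t' [t'0 ->]]] := frac_repr w.
  move=> /num0 s0 /num0 s'0; rewrite mulf_div -!tofracM !vE ?mulf_neq0 // !ordM //; lia.
exists v; last first.
  move=> n z; have [->|z0'] := eqVneq z 0.
    by split=> // _; left; rewrite tofrac0.
  have ord1 : ord 1 = 0%N.
    by have := ordM 1 1 (oner_neq0 _) (oner_neq0 _); rewrite mulr1; lia.
  have vz : v z%:F = ord z.
    by rewrite -[z%:F]divr1 -tofrac1 vE ?oner_eq0 // ord1 subr0.
  rewrite ordJ //; split=> [h|[/eqP|]]; last by rewrite vz.
    by right; rewrite vz.
  by rewrite tofrac_eq0 (negPf z0').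
split=> //.
  move=> z w; have [s [t [t0 ->]]] := frac_repr z.
  have [s' [t' [t'0 ->]]] := frac_repr w.
  move=> /num0 s0 /num0 s'0; rewrite addf_div ?tofrac_eq0 // -!tofracM -tofracD.
  move=> /num0 hs; rewrite !vE ?mulf_neq0 // ordM //.
  have h1 := ordM _ _ s0 t'0; have h2 := ordM _ _ s'0 t0.
  have := @ordD (s * t') (s' * t) (minn (ord (s * t')) (ord (s' * t))).
  rewrite !mulf_neq0 // => /(_ isT isT hs (geq_minl _ _) (geq_minr _ _)).
  rewrite h1 h2 ge_min; lia.
have [u u0 vu] : exists2 u : K, u != 0 & v u = 1.
  have z0n : z0 != 0 by apply/eqP => e; apply: hz0'; rewrite e.
  have z1n : z1 != 0 by apply/eqP => e; apply: hz1'; rewrite e.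
  exists (z1%:F / z0%:F); first by rewrite mulf_neq0 ?invr_eq0 ?tofrac_eq0.
  by rewrite vE // (ordE _ _ hz1 hz1') (ordE _ _ hz0 hz0'); lia.
have v1 : v 1 = 0 by have := vM 1 1 (oner_neq0 _) (oner_neq0 _); rewrite mulr1; lia.
have vX w n : w != 0 -> v (w ^+ n) = v w *+ n.
  move=> w0; elim: n => [|n IH]; first by rewrite expr0 v1.
  by rewrite exprS vM ?expf_neq0 // IH mulrS.
have vV : v u^-1 = -1.
  by have := vM u u^-1 u0; rewrite invr_eq0 u0 divff // v1 vu => /(_ isT); lia.
case=> n; first by exists (u ^+ n); rewrite ?expf_neq0 // vX // vu; lia.
exists (u^-1 ^+ n.+1); first by rewrite expf_neq0 ?invr_eq0.
by rewrite vX ?invr_eq0 // vV NegzE mulNrn; lia.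
Qed.

Lemma prime_valuation (g : R) : g != 0 -> ~ divides g 1 ->
  (forall u v, divides g (u * v) -> divides g u \/ divides g v) ->
  (forall z, (forall n, divides (g ^+ n) z) -> z = 0) ->
  exists2 v : K -> int, discrete_valuation v &
    forall n z, divides (g ^+ n) z <-> valuation_ge v n z%:F.
Proof.
move=> g0 g1 gp gsep.
have notdiv n z : divides (g ^+ n) z -> ~ divides (g ^+ n.+1) z ->
    exists2 c, z = c * g ^+ n & ~ divides g c.
  by move=> [c ->] h; exists c => // -[d e]; apply: h; exists d; rewrite e exprS mulrA.
have divdiv n c : divides (g ^+ n.+1) (c * g ^+ n) -> divides g c.
  move=> [d e]; exists d; apply: (mulIf (expf_neq0 n g0)).
  by rewrite e exprS mulrA.
apply: (@filtration_valuation (fun n => divides (g ^+ n))).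
- by move=> n; exact: divides_ideal.
- by move=> z; exists z; rewrite mulr1.
- by move=> n z [c ->]; exists (c * g); rewrite exprS mulrA.
- move=> z z0; apply: contrapT => h; move/eqP: z0; apply; apply: gsep => n.
  by apply: contrapT => hn; apply: h; exists n.
- move=> n k z w h1 h2 h3 h4.
  have [c -> hc] := notdiv _ _ h1 h2; have [d -> hd] := notdiv _ _ h3 h4.
  have -> : c * g ^+ n * (d * g ^+ k) = c * d * g ^+ (n + k) by rewrite exprD; ring.
  by split; [exists (c * d)|move=> /divdiv /gp []].
- exists g, 1, 0%N; split.
  + by exists 1; rewrite mul1r.
  + by move=> h; apply: g1; apply: (divdiv 1%N); rewrite mul1r.
  + by exists 1; rewrite mul1r.
  + by rewrite expr1.
Qed.

End Valuation.

(** * A regular local ring is an intersection of discrete valuation rings *)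

Section Normal.
Variables (R : idomainType) (x y : R).
Hypothesis Rxy : regular_pair x y.
Local Notation K := {fraction R}.
Local Notation "s %:F" := (FracField.tofrac s).

(** Suppose that k = s / t is not in R, and choose c with ((t) : c s) maximal
    among the proper ideals of this form; it is prime.  It cannot contain both x
    and y, so it is generated by some g ([prime_principal]).  Then t = t' g and
    c s = w t' with g not dividing w, so s has smaller g-adic order than t. *)
Lemma regular_normal (k : K) :
  (forall V, dvr V -> @fracR R `<=` V -> V k) -> fracR k.
Proof.
move=> hV; have [s [t [t0 ek]]] := frac_repr k.
case: (Rxy) => noeR unit proper x0 y0 xy.
have [[c e]|hst] := pselect (divides t s).
  by exists c => //; rewrite ek e tofracM mulfK // tofrac_eq0.
exfalso.
pose Q c : set R := [set z | divides t (z * (c * s))].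
have QI c : is_ideal (Q c).
  split; first by exists 0; rewrite !mul0r.
  by move=> d u v [a ea] [b eb]; exists (d * a + b); rewrite mulrDl -mulrA ea eb; ring.
have [||P [c [hc eP]] Pmax] := @noetherian_max R noeR
    [set J | exists c, ~ divides t (c * s) /\ J = Q c] (Q 1).
- by exists 1; rewrite mul1r.
- by move=> J [c [_ ->]].
subst P.
have Qp u v : Q c (u * v) -> Q c u \/ Q c v.
  move=> huv; have [|hv] := pselect (Q c v); [by right|left].
  apply: (Pmax (Q (v * c))).
  - exists (v * c); split => //; by rewrite -mulrA.
  - by move=> z [d e]; exists (v * d); rewrite -mulrA mulrCA e mulrA.
  - by move: huv; rewrite /Q /= !mulrA.
have Q1 : ~ Q c 1 by rewrite /Q /= mul1r.
have tQ : Q c t by exists (c * s); rewrite mulrC.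
have [g Qg hg] : exists2 g, Q c g & forall p, Q c p -> divides g p.
  have [Qx|Qx] := pselect (Q c x); last first.
    exact: (prime_principal noeR unit proper (QI c) Qp Qx).
  have [Qy|Qy] := pselect (Q c y); last first.
    have [noeR' unit' proper' _ _ _] := regular_pairC Rxy.
    exact: (prime_principal noeR' unit' proper' (QI c) Qp Qy).
  (* If x (c s) = u t and y (c s) = w t, then x w = y u, so x divides u and t
     divides c s. *)
  exfalso; case: Qx => u eu; case: Qy => w ew.
  have [|d ed] := xy w u.
    apply: (mulfI t0); transitivity (x * (y * (c * s))); first by rewrite ew; ring.
    by rewrite mulrCA eu; ring.
  by apply: hc; exists d; apply: (mulfI x0); rewrite eu ed; ring.
have g0 : g != 0.
  by apply/eqP => g0; have [d ed] := hg _ tQ; move: t0; rewrite ed g0 mulr0 eqxx.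
have g1 : ~ divides g 1 by case=> d e; apply: Q1; rewrite e; exact: idealM.
have gin : ideal2 x y g.
  by apply: contrapT => /unit ug; apply: g1; exists g^-1; rewrite mulVr.
have [||v [v1 v2 v3] hv] := @prime_valuation R g g0 g1.
- move=> u w [d e]; have : Q c (u * w) by rewrite e; exact: idealM.
  by case/Qp => /hg; [left|right].
- move=> z hz; have [||d ->] := @krull_intersection R noeR 0 g z.
  + by move=> d; exact: (unit_sub1 unit proper).
  + by move=> n; have [d ->] := hz n; exact: ideal2r.
  by rewrite mulr0.
have [w ew] := Qg; have [t' et] := hg _ tQ.
have ecs : c * s = w * t' by apply: (mulfI g0); rewrite ew et; ring.
have t'0 : t' != 0 by apply: contraNneq t0 => e; rewrite et e mul0r.
have s0 : s != 0 by apply/eqP => s0; apply: hc; rewrite s0 mulr0; case: (divides_ideal t).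
have c0 : c != 0 by apply/eqP => c0; apply: hc; rewrite c0 mul0r; case: (divides_ideal t).
have w0 : w != 0.
  by apply: contraNneq (mulf_neq0 c0 s0) => w0; rewrite ecs w0 mul0r.
have hw : ~ divides g w by move=> [d e]; apply: hc; exists d; rewrite ecs et e; ring.
have vpos z : z != 0 -> 0 <= v z%:F.
  move=> z0; have [h _] := hv 0%N z; have [|ez|//] := h; first by exists z; rewrite mulr1.
  by move/eqP: ez; rewrite tofrac_eq0 (negPf z0).
have vw : v w%:F <= 0.
  rewrite leNgt; apply/negP => h; apply: hw; rewrite -[g]expr1; apply/hv; right; lia.
have vg : 1 <= v g%:F.
  have [|/eqP|//] := (hv 1%N g).1; first by exists 1; rewrite mul1r.
  by rewrite tofrac_eq0 (negPf g0).
have F0 z : z != 0 -> z%:F != 0 :> K by rewrite tofrac_eq0.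
have e1 := v1 _ _ (F0 _ c0) (F0 _ s0); have e2 := v1 _ _ (F0 _ w0) (F0 _ t'0).
have e3 := v1 _ _ (F0 _ t'0) (F0 _ g0).
rewrite -tofracM ecs tofracM e2 in e1; rewrite -tofracM -et in e3.
have kn0 : k != 0 by rewrite ek mulf_neq0 ?invr_eq0 ?F0.
have ets : v s%:F = v k + v t%:F by rewrite -v1 ?F0 // ek divfK ?F0.
have [||ek0|vk] := hV (valuation_ge v 0).
- by exists v.
- by move=> _ [z _ <-]; have [->|/vpos] := eqVneq z 0; [left; rewrite tofrac0|right].
- by rewrite ek0 eqxx in kn0.
have := vpos c c0; lia.
Qed.

End Normal.

(** * Monomial ideals *)

Definition upclosed (S : nat -> nat -> Prop) : Prop :=
  forall i j k l, S i j -> (i <= k)%N -> (j <= l)%N -> S k l.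

(** For an up-closed S containing powers of both variables, this is the ideal
    generated by the monomials with exponent in S (see [mon_least]), written as
    an intersection of irreducible monomial ideals.  In this form membership of a
    monomial, inclusions and division by a monomial are all immediate. *)
Definition mon (R : comNzRingType) (x y : R) (S : nat -> nat -> Prop) : set R :=
  [set z | forall i j, ~ S i j -> ideal2 (x ^+ i.+1) (y ^+ j.+1) z].

Definition weight_ge (p q n i j : nat) : Prop := (n <= p * i + q * j)%N.

Section RegularSequence.
Variables (R : idomainType).

Lemma regular_powers (x y : R) a b u v : regular_pair x y ->
  x ^+ a * u = y ^+ b * v -> divides (x ^+ a) v.
Proof.
move=> [_ _ _ x0 _ xy].
have xyb w z : x * w = y ^+ b * z -> divides x z.
  elim: b w z => [|b IH] w z; first by rewrite mul1r => <-; exists w; rewrite mulrC.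
  rewrite exprS -mulrA => /xy [c ec]; apply: (IH c); by rewrite ec mulrC.
elim: a u v => [|a IH] u v e; first by exists v; rewrite mulr1.
have [|v' ev] := xyb (x ^+ a * u) v; first by rewrite mulrA -exprS.
have [|c ec] := IH u v'; first by apply: (mulfI x0); rewrite mulrA -exprS e ev; ring.
by exists c; rewrite ev ec exprSr mulrA.
Qed.

Lemma ideal2_cancel (x y : R) k a b z : regular_pair x y ->
  ideal2 (x ^+ (a + k)) (y ^+ b) (x ^+ k * z) -> ideal2 (x ^+ a) (y ^+ b) z.
Proof.
move=> Rxy [c [d e]].
have [|w ew] := regular_powers (u := z - c * x ^+ a) (v := d) (a := k) (b := b) Rxy.
  by rewrite mulrBr e exprD; ring.
exists c, w; apply: (mulfI (expf_neq0 k (rp_x0 Rxy))).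
by rewrite e ew exprD; ring.
Qed.

Variables (x y : R).
Hypothesis Rxy : regular_pair x y.

Lemma ideal2_cancelr k a b z :
  ideal2 (x ^+ a) (y ^+ (b + k)) (y ^+ k * z) -> ideal2 (x ^+ a) (y ^+ b) z.
Proof. by move=> /ideal2C /(ideal2_cancel (regular_pairC Rxy)) /ideal2C. Qed.

Lemma ideal2_coef a b u :
  ideal2 (x ^+ a.+1) (y ^+ b.+1) (u * (x ^+ a * y ^+ b)) -> ideal2 x y u.
Proof.
rewrite mulrC -mulrA -[a.+1]add1n => /(ideal2_cancel Rxy).
by rewrite -[b.+1]add1n => /ideal2_cancelr.
Qed.

Lemma ideal2_unit_coef a b u : u \is a GRing.unit ->
  ~ ideal2 (x ^+ a.+1) (y ^+ b.+1) (u * (x ^+ a * y ^+ b)).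
Proof. by move=> uu /ideal2_coef; exact: (nonunit (rp_proper Rxy)). Qed.

Lemma mon_ideal S : is_ideal (mon x y S).
Proof.
split=> [i j _|c u v hu hv i j hS]; first by case: (ideal2_ideal (x ^+ i.+1) (y ^+ j.+1)).
by case: (ideal2_ideal (x ^+ i.+1) (y ^+ j.+1)) => _; apply; [exact: hu|exact: hv].
Qed.

Lemma ideal2_monomial a b k l : (a <= k)%N \/ (b <= l)%N ->
  ideal2 (x ^+ a) (y ^+ b) (x ^+ k * y ^+ l).
Proof.
case=> h.
  by rewrite -(subnK h) exprD mulrAC; exact: ideal2l.
by rewrite -(subnK h) exprD mulrA; exact: ideal2r.
Qed.

Lemma mon_monomial S i j : upclosed S -> mon x y S (x ^+ i * y ^+ j) <-> S i j.
Proof.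
move=> Sup; split=> [h|hS k l nS].
  apply: contrapT => /h; rewrite -[_ * _]mul1r; apply: ideal2_unit_coef; exact: unitr1.
apply: ideal2_monomial; have [|h1] := leqP k.+1 i; first by left.
by right; rewrite ltnNge; apply/negP => h2; apply: nS; apply: Sup hS _ _.
Qed.

Lemma mon_sub S S' : (forall i j, S i j -> S' i j) -> mon x y S `<=` mon x y S'.
Proof. by move=> h z hz i j hS; apply: hz => /h. Qed.

(** Induction on the number of columns of the complement of S.  If h is the least
    power of y in S, then z = s x + t y^h, and s belongs to the ideal of S shifted
    by one column. *)
Lemma mon_least S A B (T : set R) : upclosed S -> S A 0%N -> S 0%N B ->
  is_ideal T -> (forall i j, S i j -> T (x ^+ i * y ^+ j)) -> mon x y S `<=` T.
Proof.
elim: A S T => [|A IH] S T Sup SA SB TI TS z hz.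
  rewrite -[z]mulr1; apply: idealM => //; have := TS _ _ SA; by rewrite !expr0 mulr1.
have [h [Sh hh]] : exists h, S 0%N h /\ exists s t, z = s * x + t * y ^+ h.
  have exh : exists h, `[< S 0%N h >] by exists B; apply/asboolP.
  case: (ex_minnP exh) => h /asboolP Sh hmin; exists h; split => //.
  case: h Sh hmin => [|h] Sh hmin; first by exists 0, z; rewrite mul0r add0r mulr1.
  have [|s [t e]] := hz 0%N h; last by exists s, t.
  by move=> /asboolP /hmin; rewrite ltnn.
case: hh => s [t e].
have Ty : T (y ^+ h) by have := TS _ _ Sh; rewrite mul1r.
rewrite e; apply: idealD => //; last exact: idealM.
apply: (IH (fun i j => S i.+1 j) [set w | T (w * x)]).
- by move=> i j k l hS ik jl; apply: Sup hS _ _.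
- exact: SA.
- exact: Sup SB _ _.
- by case: TI => T0 T1; split=> [|c u v hu hv]; rewrite /= ?mul0r // mulrDl -mulrA; apply: T1.
- by move=> i j hS /=; rewrite mulrC mulrA -exprS; exact: TS.
move=> i j nS; apply: (@ideal2_cancel x y 1 _ _ _ Rxy); rewrite addn1 expr1 mulrC.
rewrite (_ : s * x = z - t * y ^+ h); last by rewrite e addrK.
apply: (idealB (ideal2_ideal _ _)); first exact: hz.
apply: idealM; first exact: ideal2_ideal.
rewrite -[y ^+ h]mul1r -[1](expr0 x).
apply: (mon_monomial _ _ Sup).2 Sh _ _ nS.
Qed.

(** The monomial ideal then contains powers of x and of y, so it is primary to the
    ideal (x, y). *)
Definition primary (S : nat -> nat -> Prop) : Prop :=
  (exists A, S A 0%N) /\ exists B, S 0%N B.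

Lemma mon_mul S S' T z w : upclosed S -> primary S -> upclosed S' -> primary S' ->
  upclosed T -> (forall i j k l, S i j -> S' k l -> T (i + k)%N (j + l)%N) ->
  mon x y S z -> mon x y S' w -> mon x y T (z * w).
Proof.
move=> Sup [[A SA] [B SB]] S'up [[A' SA'] [B' SB']] Tup hT hz.
have [Tz0 Tadd] := mon_ideal T.
apply: (mon_least (T := [set w | mon x y T (z * w)]) S'up SA' SB').
  split=> [|c u v hu hv]; rewrite /= ?mulr0 // mulrDr mulrCA; exact: Tadd.
move=> k l hS' /=; move: z hz.
apply: (mon_least (T := [set z | mon x y T (z * (x ^+ k * y ^+ l))]) Sup SA SB).
  split=> [|c u v hu hv]; rewrite /= ?mul0r // mulrDl -mulrA; exact: Tadd.
move=> i j hS /=; rewrite (_ : _ * _ = x ^+ (i + k) * y ^+ (j + l)); last first.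
  by rewrite !exprD; ring.
by apply/mon_monomial => //; exact: hT.
Qed.

Lemma mon_split S S1 i j z : upclosed S -> primary S -> upclosed S1 ->
  (forall k l, S k l -> S1 k l \/ (k = i /\ l = j)) -> mon x y S z ->
  exists u, mon x y S1 (z - u * (x ^+ i * y ^+ j)).
Proof.
move=> Sup [[A SA] [B SB]] S1up hS.
have [Tz0 Tadd] := mon_ideal S1.
apply: (mon_least (T := [set z | exists u, mon x y S1 (z - u * (x ^+ i * y ^+ j))]) Sup SA SB).
  split=> [|c u v [a ha] [b hb]]; first by exists 0; rewrite mul0r subr0.
  exists (c * a + b); rewrite (_ : _ - _ = c * (u - a * (x ^+ i * y ^+ j)) +
    (v - b * (x ^+ i * y ^+ j))); last by ring.
  exact: Tadd.
move=> k l /hS [h|[-> ->]].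
  by exists 0; rewrite mul0r subr0; apply/mon_monomial.
by exists 1; rewrite mul1r subrr.
Qed.

(** * Monomial valuations *)

Section Weights.
Variables p q : nat.
Hypotheses (p0 : (0 < p)%N) (q0 : (0 < q)%N).

Lemma weight_ge_up n : upclosed (weight_ge p q n).
Proof. by move=> i j k l; rewrite /weight_ge => h1 h2 h3; nia. Qed.

Lemma weight_ge_primary n : primary (weight_ge p q n).
Proof. by split; exists n; rewrite /weight_ge; nia. Qed.

(** The monomials of weight n are ordered by their x-degree, so that a leading
    form has a first monomial; those of larger weight come after all of them. *)
Definition lead_ge (n i0 i j : nat) : Prop :=
  (n < p * i + q * j)%N \/ (n = p * i + q * j)%N /\ (i0 <= i)%N.

Lemma lead_ge_up n i0 : upclosed (lead_ge n i0).
Proof. by move=> i j k l; rewrite /lead_ge => h1 h2 h3; nia. Qed.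

Lemma lead_ge_primary n i0 : primary (lead_ge n i0).
Proof. by split; exists n.+1; rewrite /lead_ge; nia. Qed.

(** Take, among the exponents of weight n at which the membership of z in
    weight n + 1 fails, the one of least x-degree.  Its coefficient is a unit: a
    coefficient in (x, y) would put z in (x^(i+1), y^(j+1)). *)
Lemma leading_monomial n z : mon x y (weight_ge p q n) z ->
  ~ mon x y (weight_ge p q n.+1) z ->
  exists i j u, [/\ (p * i + q * j = n)%N, u \is a GRing.unit,
    mon x y (lead_ge n i) z &
    mon x y (lead_ge n i.+1) (z - u * (x ^+ i * y ^+ j))].
Proof.
move=> h1 h2.
pose L i := `[< exists j, (p * i + q * j = n)%N /\ ~ ideal2 (x ^+ i.+1) (y ^+ j.+1) z >].
have exL : exists i, L i.
  apply: contrapT => hno; apply: h2 => i j; rewrite /weight_ge => hn.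
  have [hlt|hge] := ltnP (p * i + q * j) n; first by apply: h1; rewrite /weight_ge; lia.
  apply: contrapT => hz; apply: hno; exists i; apply/asboolP; exists j; split => //; lia.
case: (ex_minnP exL) => i /asboolP [j [en nz]] imin.
have hl : mon x y (lead_ge n i) z.
  move=> k l hkl; have [hlt|hge] := ltnP (p * k + q * l) n.
    by apply: h1; rewrite /weight_ge; lia.
  apply: contrapT => hz; have : (i <= k)%N.
    apply: imin; apply/asboolP; exists l; split => //.
    by apply: contrapT => e; apply: hkl; left; lia.
  by move=> ik; apply: hkl; rewrite /lead_ge; lia.
have [|u hu] := @mon_split (lead_ge n i) (lead_ge n i.+1) i j z (@lead_ge_up n i)
   (@lead_ge_primary n i) (@lead_ge_up n i.+1) _ hl.
  by move=> k l; rewrite /lead_ge; nia.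
exists i, j, u; split => //; apply: (rp_unit Rxy) => -[c [d eu]]; apply: nz.
rewrite (_ : z = (z - u * (x ^+ i * y ^+ j)) + u * (x ^+ i * y ^+ j)); last by rewrite subrK.
apply: (idealD (ideal2_ideal _ _)); first by apply: hu; rewrite /lead_ge; lia.
by exists (c * y ^+ j), (d * x ^+ i); rewrite eu !exprS; ring.
Qed.

(** The first monomials of the two leading forms multiply to a monomial with a
    unit coefficient, and all the other products come later.  This is the proof
    that a polynomial ring over a field is a domain. *)
Lemma weight_mult n k z w :
  mon x y (weight_ge p q n) z -> ~ mon x y (weight_ge p q n.+1) z ->
  mon x y (weight_ge p q k) w -> ~ mon x y (weight_ge p q k.+1) w ->
  mon x y (weight_ge p q (n + k)) (z * w) /\
  ~ mon x y (weight_ge p q (n + k).+1) (z * w).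
Proof.
move=> hz hz' hw hw'; split.
  apply: (mon_mul (@weight_ge_up n) (weight_ge_primary n) (@weight_ge_up k)
    (weight_ge_primary k) (@weight_ge_up (n + k)) _ hz hw).
  by move=> i j i' j'; rewrite /weight_ge; lia.
have [i [j [u [en uu hz0 hz1]]]] := leading_monomial hz hz'.
have [i' [j' [u' [ek uu' hw0 hw1]]]] := leading_monomial hw hw'.
move=> /(_ (i + i')%N (j + j')%N); rewrite /weight_ge => h.
have : u * u' \is a GRing.unit by rewrite unitrM uu.
move=> /(@ideal2_unit_coef (i + i') (j + j')); apply.
set a := x ^+ i * y ^+ j in hz1 *; set b := x ^+ i' * y ^+ j' in hw1 *.
rewrite (_ : _ * _ = z * w - ((z - u * a) * w + u * a * (w - u' * b))); last first.
  by rewrite /a /b !exprD; ring.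
apply: (idealB (ideal2_ideal _ _)); first by apply: h; lia.
have nT : ~ lead_ge (n + k) (i + i').+1 (i + i') (j + j') by rewrite /lead_ge; lia.
apply: (idealD (ideal2_ideal _ _)).
  apply: (mon_mul (@lead_ge_up n i.+1) (lead_ge_primary n i.+1) (@lead_ge_up k i')
    (lead_ge_primary k i') (@lead_ge_up (n + k) (i + i').+1) _ hz1 hw0) nT.
  by move=> a1 a2 a3 a4; rewrite /lead_ge; nia.
have ha : mon x y (lead_ge n i) a.
  by apply/mon_monomial; [exact: lead_ge_up|rewrite /lead_ge; lia].
rewrite -mulrA; apply: (idealM _ (ideal2_ideal _ _)).
apply: (mon_mul (@lead_ge_up n i) (lead_ge_primary n i) (@lead_ge_up k i'.+1)
  (lead_ge_primary k i'.+1) (@lead_ge_up (n + k) (i + i').+1) _ ha hw1) nT.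
by move=> a1 a2 a3 a4; rewrite /lead_ge; nia.
Qed.

Local Notation K := {fraction R}.
Local Notation "s %:F" := (FracField.tofrac s).

(** The filtration is separated by Krull's theorem, applied to y modulo the
    powers of x and then to x.  As p and q are coprime, some multiple of p exceeds
    some multiple of q by one, and the corresponding powers of x and y have
    consecutive orders. *)
Lemma monomial_valuation : coprime p q ->
  exists2 v : K -> int, discrete_valuation v &
    forall n z, mon x y (weight_ge p q n) z <-> valuation_ge v n z%:F.
Proof.
move=> pq; apply: filtration_valuation.
- by move=> n; exact: mon_ideal.
- by move=> z i j; rewrite /weight_ge.
- by move=> n; apply: mon_sub => i j; rewrite /weight_ge; lia.
- move=> z z0; apply: contrapT => hno; move/eqP: z0; apply.
  have hz a b : ideal2 (x ^+ a.+1) (y ^+ b.+1) z.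
    apply: contrapT => h; apply: hno; exists (p * a + q * b).+1 => /(_ a b).
    by move=> h'; apply: h; apply: h'; rewrite /weight_ge; lia.
  have [noeR unit proper x0 y0 _] := Rxy.
  have hx a : divides (x ^+ a.+1) z.
    apply: (krull_intersection noeR (z := y)) => [c|[|b]] //.
      by apply: (unit_sub1 unit proper); exact: ideal2_snd.
    by rewrite -[z]mulr1; exact: ideal2r.
  have [||c ->] := @krull_intersection R noeR 0 x z.
  + by move=> c; apply: (unit_sub1 unit proper); exact: ideal2_fst.
  + move=> [|a]; first by rewrite -[z]mulr1; exact: ideal2r.
    by have [c ->] := hx a; exact: ideal2r.
  by rewrite mulr0.
- by move=> n k z w; exact: weight_mult.
have /(coprimeP q p0) [[s t] /= hst] := pq.
exists (x ^+ s * y ^+ 0), (x ^+ 0 * y ^+ t), (t * q)%N.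
split; rewrite ?mon_monomial /weight_ge; try exact: weight_ge_up; lia.
Qed.

End Weights.
End RegularSequence.

(** * The Fitting ideal *)

Section FittingIdeal.
Variables (R : idomainType) (d : nat).
Local Notation K := {fraction R}.
Local Notation "s %:F" := (FracField.tofrac s).
Local Notation mapF := (map_mx (fun s : R => s%:F)).

Lemma mapF_inj m n : injective (mapF : 'M[R]_(m, n) -> 'M[K]_(m, n)).
Proof.
move=> u v /matrixP h; apply/matrixP => i j.
by have := h i j; rewrite !mxE => /eqP; rewrite tofrac_eq => /eqP.
Qed.

Lemma mapF0 m n : mapF (0 : 'M[R]_(m, n)) = 0.
Proof. by apply/matrixP => i j; rewrite !mxE tofrac0. Qed.

Lemma mapFD m n (u v : 'M[R]_(m, n)) : mapF (u + v) = mapF u + mapF v.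
Proof. by apply/matrixP => i j; rewrite !mxE tofracD. Qed.

Lemma mapFB m n (u v : 'M[R]_(m, n)) : mapF (u - v) = mapF u - mapF v.
Proof. by apply/matrixP => i j; rewrite !mxE tofracB. Qed.

Lemma mapFZ m n c (u : 'M[R]_(m, n)) : mapF (c *: u) = c%:F *: mapF u.
Proof. by apply/matrixP => i j; rewrite !mxE tofracM. Qed.

Lemma mapF_sum m n (I : Type) (r : seq I) (P : pred I) (F : I -> 'M[R]_(m, n)) :
  mapF (\sum_(i <- r | P i) F i) = \sum_(i <- r | P i) mapF (F i).
Proof. exact: (big_morph _ (@mapFD m n) (@mapF0 m n)). Qed.

Definition coordinate (l : 'I_d) (v : 'rV[K]_d) : K^o := v 0 l.

Lemma coordinate_linear l : linear (coordinate l).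
Proof. by move=> c u v; rewrite /coordinate !mxE. Qed.

HB.instance Definition _ l :=
  GRing.isLinear.Build K 'rV[K]_d K^o _ (coordinate l) (coordinate_linear l).

Variable M : set 'rV[R]_d.
Hypothesis MI : is_submod M.

(** A linear form that takes M into R takes F into both x^-a R and y^-b R, and
    these meet in R because x^a, y^b is a regular sequence. *)
Lemma double_dual_free (x y : R) a b : regular_pair x y ->
  (forall u, M (x ^+ a *: u)) -> (forall u, M (y ^+ b *: u)) ->
  double_dual M = frac_emb [set: 'rV[R]_d].
Proof.
move=> Rxy Ma Mb; have xa0 := expf_neq0 a (rp_x0 Rxy).
apply/seteqP; split => [v [_ hv]|_ [u _ <-]].
  have /choice [u hu] : forall l, exists u, u%:F = v 0 l.
    move=> l; have [|u _ e] := hv (coordinate l); last by exists u.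
    by move=> _ [w _ <-]; exists (w 0 l) => //=; rewrite /coordinate mxE.
  by exists (\row_l u l) => //; apply/rowP => l; rewrite !mxE hu.
have xa0F : (x ^+ a)%:F != 0 :> K by rewrite tofrac_eq0.
split.
  have -> : mapF u = (x ^+ a)%:F^-1 *: mapF (x ^+ a *: u).
    by rewrite mapFZ scalerA mulVf // scale1r.
  apply: submodZ; first exact: lspan_submod.
  by apply: lspan_incl; exists (x ^+ a *: u).
move=> psi hpsi.
have [s _ es] : fracR ((x ^+ a)%:F * psi (mapF u)).
  have [|s _ es] := hpsi (mapF (x ^+ a *: u)); first by exists (x ^+ a *: u).
  by exists s; rewrite // es mapFZ linearZ.
have [t _ et] : fracR ((y ^+ b)%:F * psi (mapF u)).
  have [|t _ et] := hpsi (mapF (y ^+ b *: u)); first by exists (y ^+ b *: u).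
  by exists t; rewrite // et mapFZ linearZ.
have [|w ew] := @regular_powers R x y a b t s Rxy.
  by apply/eqP; rewrite -tofrac_eq !tofracM es et mulrCA.
by exists w => //; apply: (mulfI xa0F); rewrite -es ew tofracM mulrC.
Qed.

(** Expanding k times along the first column leaves determinants of matrices
    formed by d rows of the last d columns. *)
Lemma det_last_columns k (J : set R) (T : 'M[R]_(k + d)) : is_ideal J ->
  (forall N : 'M[R]_d, (forall i, M (row i N)) -> J (\det N)) ->
  (forall i, M (\row_l T i (rshift k l))) -> J (\det T).
Proof.
move=> JI hJ; elim: k T => [|k IH] T hT.
  apply: hJ => i; rewrite (_ : row i T = \row_l T i (rshift 0 l)) //.
  by apply/rowP => l; rewrite !mxE; congr (T _ _); exact: val_inj.
rewrite (expand_det_col _ 0); apply: ideal_sum => // i _; apply: idealM => //.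
apply: idealM => //; apply: (IH (row' i (col' 0 T))) => i'.
rewrite (_ : \row_l _ = \row_l T (lift i i') (rshift k.+1 l)) //.
by apply/rowP => l; rewrite !mxE; congr (T _ _); exact: val_inj.
Qed.

Hypothesis Mfree : double_dual M = frac_emb [set: 'rV[R]_d].

Lemma ideal_of_module_det (N : 'M[R]_d) : (forall i, M (row i N)) ->
  ideal_of_module M (\det N).
Proof.
move=> hN; exists d, (fun j => mapF (delta_mx 0 j)); rewrite Mfree.
have lin (c : 'rV[R]_d) : \sum_(j < d) (c 0 j)%:F *: mapF (delta_mx 0 j) = mapF c.
  rewrite [in RHS](row_sum_delta c) mapF_sum; apply: eq_bigr => j _.
  by rewrite mapFZ.
split.
- by move=> j; exists (delta_mx 0 j).
- move=> _ [u _ <-]; exists (fun j => u 0 j); rewrite lin subrr.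
  by exists 0; [case: MI|rewrite mapF0].
- apply: lspan_incl; exists N => // i; exists (row i N) => //; rewrite -lin.
  by apply: eq_bigr => j _; rewrite mxE.
Qed.

(** The Fitting ideal can be computed with the standard basis instead of an
    arbitrary generating family p.  Write p_j as the row j of B, let
    eps_l = sum_j C_lj p_j modulo M, and let A be a matrix of relations between
    the p_j.  Column operations turn the block matrix with rows (A, 0) and
    (-C, 1), of determinant det A, into the one with rows (A, A B) and
    (-C, 1 - C B), whose last columns have their rows in M. *)
Lemma ideal_of_module_sub (J : set R) : is_ideal J ->
  (forall N : 'M[R]_d, (forall i, M (row i N)) -> J (\det N)) ->
  ideal_of_module M `<=` J.
Proof.
move=> JI hJ z [k [p [hp hgen hz]]]; move: z hz.
apply: (@lspan_least R R^o _ J) => // _ [A hA <-].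
have /choice [B hB] : forall j, exists u : 'rV[R]_d, mapF u = p j.
  by move=> j; have := hp j; rewrite Mfree => -[u _ <-]; exists u.
pose Bm := \matrix_(j, l) B j 0 l : 'M[R]_(k, d).
have comb (c : 'I_k -> R) : \sum_(j < k) (c j)%:F *: p j = mapF ((\row_j c j) *m Bm).
  rewrite mulmx_sum_row mapF_sum; apply: eq_bigr => j _.
  rewrite mapFZ mxE -hB; congr (_ *: mapF _).
  by apply/rowP => l; rewrite !mxE.
have hAB i : M (row i (A *m Bm)).
  have [u hu] := hA i; rewrite comb => /mapF_inj eu.
  rewrite row_mul; suff -> : row i A *m Bm = u by [].
  by rewrite eu; congr (_ *m _); apply/rowP => j; rewrite !mxE.
have /choice [C hC] : forall l : 'I_d, exists c : 'rV[R]_k, M (delta_mx 0 l - c *m Bm).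
  move=> l; have [|c [u hu]] := hgen (mapF (delta_mx 0 l)).
    by rewrite Mfree; exists (delta_mx 0 l).
  by rewrite comb -mapFB => /mapF_inj eu; exists (\row_j c j); rewrite -eu.
pose Cm := \matrix_(l, j) C l 0 j : 'M[R]_(d, k).
have hCB l : M (row l (1%:M - Cm *m Bm)).
  rewrite linearB /= row1 row_mul (_ : row l Cm = C l) //.
  by apply/rowP => j; rewrite !mxE.
have -> : \det A = \det (block_mx A 0 (- Cm) 1%:M *m block_mx 1%:M Bm 0 1%:M).
  by rewrite det_mulmx det_lblock det_ublock !det1 !mulr1.
rewrite mulmx_block !mulmx0 !mul0mx !mulmx1 !addr0 mulNmx.
apply: det_last_columns => // i; case: (split_ordP i) => i' ->.
  rewrite (_ : \row_l _ = row i' (A *m Bm)) //.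
  by apply/rowP => l; rewrite [LHS]mxE block_mxEur [RHS]mxE.
rewrite (_ : \row_l _ = row i' (1%:M - Cm *m Bm)) //.
by apply/rowP => l; rewrite [LHS]mxE block_mxEdr [RHS]mxE !mxE addrC.
Qed.

End FittingIdeal.

(** * The linear form whose kernel is generated by the g_i *)

Section MinorForm.
Variables (R : idomainType) (x y : R) (n : nat).
Hypothesis Rxy : regular_pair x y.

(** The coefficients are the signed maximal minors of the matrix with rows
    g_1, ..., g_n, so the value at u is the determinant of the matrix obtained by
    adding the row u (see [det_bordered]). *)
Definition minor_form (u : 'rV[R]_n.+1) : R :=
  \sum_l u 0 l * ((-1) ^+ l * (x ^+ (n - l) * y ^+ l)).

Lemma minor_form_linear c u v : minor_form (c *: u + v) = c * minor_form u + minor_form v.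
Proof.
rewrite /minor_form mulr_sumr -big_split /=; apply: eq_bigr => l _.
by rewrite !mxE; ring.
Qed.

Lemma minor_formZ c u : minor_form (c *: u) = c * minor_form u.
Proof.
have := minor_form_linear c u 0; rewrite addr0 => ->.
by rewrite [minor_form 0]big1 ?addr0 // => l _; rewrite mxE mul0r.
Qed.

Lemma minor_formD u v : minor_form (u + v) = minor_form u + minor_form v.
Proof. by have := minor_form_linear 1 u v; rewrite scale1r mul1r. Qed.

Lemma minor_formB u v : minor_form (u - v) = minor_form u - minor_form v.
Proof. by rewrite minor_formD -scaleN1r minor_formZ mulN1r. Qed.

Lemma minor_form_eps k : (k <= n)%N ->
  minor_form (eps R n.+1 k.+1) = (-1) ^+ k * (x ^+ (n - k) * y ^+ k).
Proof.
move=> kn; have kn' : (k < n.+1)%N by [].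
rewrite /minor_form (bigD1 (Ordinal kn')) //= mxE eqxx mul1r big1 ?addr0 // => l hl.
rewrite mxE eqSS (negPf (_ : (l : nat) != k)) ?mul0r //.
Qed.

Lemma geng_coord k j : geng x y n.+1 k.+1 0 j =
  y * ((j : nat) == k)%:R + x * ((j : nat) == k.+1)%:R.
Proof. by rewrite !mxE. Qed.

Lemma minor_form_geng k : (k < n)%N -> minor_form (geng x y n.+1 k.+1) = 0.
Proof.
move=> kn; rewrite /geng minor_formD !minor_formZ !minor_form_eps ?(ltnW kn) //.
by rewrite (_ : (n - k = (n - k.+1).+1)%N) ?exprS; [ring|lia].
Qed.

(** If the coordinates of v after the one of index k + 1 vanish, all terms of the
    form but the one of index k + 1 are divisible by x^(n-k), and the latter
    contains only x^(n-k-1).  So x divides that coordinate, and it can be removed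
    by subtracting a multiple of g_(k+1). *)
Lemma minor_form_ker (M : set 'rV[R]_n.+1) u : is_submod M ->
  (forall k, (k < n)%N -> M (geng x y n.+1 k.+1)) -> minor_form u = 0 -> M u.
Proof.
move=> MI Mg; have x0 := rp_x0 Rxy.
suff H k (v : 'rV[R]_n.+1) : (k <= n)%N -> (forall l : 'I_n.+1, (k < l)%N -> v 0 l = 0) ->
    minor_form v = 0 -> M v.
  by apply: (H n) => // l hl; have := ltn_ord l; lia.
elim: k v => [|k IH] v kn hv e.
  suff -> : v = 0 by case: MI.
  have hv' (l : 'I_n.+1) : l != 0 -> v 0 l = 0 by rewrite -lt0n; exact: hv.
  apply/rowP => l; rewrite mxE; have [->|/hv' //] := eqVneq l 0.
  move: e; rewrite /minor_form (bigD1 0) //= big1 => [|i /hv' ->]; last by rewrite mul0r.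
  rewrite addr0 subn0 !mulr1 mul1r => /eqP.
  by rewrite mulf_eq0 expf_eq0 (negPf x0) andbF orbF => /eqP.
have kn' : (k.+1 < n.+1)%N by [].
pose l0 := Ordinal kn'.
have [s es] : divides (x ^+ (n - k))
    (\sum_(l | l != l0) v 0 l * ((-1) ^+ l * (x ^+ (n - l) * y ^+ l))).
  apply: (@ideal_sum R _ _ _ _ _ (divides_ideal (x ^+ (n - k)))) => l hl.
  have [h|h] := ltnP k.+1 l; first by rewrite hv // mul0r; case: (divides_ideal (x ^+ (n - k))).
  have h' : (l <= k)%N by rewrite -ltnS ltn_neqAle h andbT.
  exists (v 0 l * (-1) ^+ l * x ^+ (k - l) * y ^+ l).
  by rewrite (_ : (n - l = (k - l) + (n - k))%N) ?exprD; [ring|lia].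
have [|c ec] := @regular_powers R x y 1 k.+1 (- s) ((-1) ^+ k.+1 * v 0 l0) Rxy.
  move: e; rewrite /minor_form (bigD1 l0) //= es => e.
  apply: (mulfI (expf_neq0 (n - k.+1) x0)); apply/eqP; rewrite -subr_eq0 -oppr_eq0; apply/eqP.
  rewrite -[RHS]e (_ : (n - k = (n - k.+1).+1)%N); last by lia.
  by rewrite !exprS; ring.
have ev : v 0 l0 = (-1) ^+ k.+1 * c * x.
  by rewrite -mulrA -[x]expr1 -ec mulrA -exprMn mulrNN mulr1 expr1n mul1r.
rewrite -[v](subrK ((-1) ^+ k.+1 * c *: geng x y n.+1 k.+1)); apply: submodD => //; last first.
  by apply: submodZ => //; exact: Mg.
apply: IH; first exact: ltnW.
  move=> l hl; rewrite 3!mxE geng_coord.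
  rewrite [_ == k]gtn_eqF // mulr0 add0r; have [h|h] := eqVneq (l : nat) k.+1.
    have -> : l = l0 by apply: val_inj.
    by rewrite ev mulr1 subrr.
  by rewrite !mulr0 subr0; apply: hv; rewrite ltn_neqAle eq_sym h.
by rewrite minor_formB minor_formZ minor_form_geng // e mulr0 subr0.
Qed.

(** Let w be the column of the coefficients of the form.  All entries of N w but
    the first vanish, and the first is the form at u; by Cramer's rule
    x^n det N is this value times the cofactor at (0, 0), which is x^n. *)
Lemma det_bordered (u : 'rV[R]_n.+1) :
  \det (\matrix_(i, j) (if i == 0 then u 0 j else geng x y n.+1 i 0 j)) = minor_form u.
Proof.
set N := \matrix_(i, j) _.
pose w := \col_(l < n.+1) ((-1) ^+ l * (x ^+ (n - l) * y ^+ l)).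
have hw i : (N *m w) i 0 = minor_form (row i N).
  by rewrite mxE; apply: eq_bigr => l _; rewrite !mxE.
have h0 i : i != 0 -> (N *m w) i 0 = 0.
  move=> i0; rewrite hw (_ : row i N = geng x y n.+1 i.-1.+1).
    have ip : (0 < i)%N by rewrite lt0n.
    by apply: minor_form_geng; have := ltn_ord i; lia.
  by apply/rowP => j; rewrite [LHS]mxE mxE (negPf i0) prednK // lt0n.
have := mulmxA (\adj N) N w; rewrite mul_adj_mx => /matrixP /(_ 0 0).
rewrite mul_scalar_mx [RHS]mxE [LHS]mxE (bigD1 0) //= big1 => [|i /h0 ->]; last by rewrite mulr0.
rewrite hw addr0 mxE /w mxE /= subn0 expr0 mul1r mulr1 (_ : row 0 N = u); last first.
  by apply/rowP => j; rewrite mxE mxE eqxx.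
have -> : cofactor N 0 0 = x ^+ n.
  have hN i j : row' 0 (col' 0 N) i j =
      y * (j.+1 == i :> nat)%:R + x * (j.+1 == i.+1 :> nat)%:R.
    rewrite 3!mxE (negPf (_ : lift 0 i != 0)); last by rewrite eq_sym neq_lift.
    by rewrite lift0 geng_coord lift0.
  rewrite /cofactor expr0 mul1r det_trig.
    rewrite -[in RHS](card_ord n) -prodr_const; apply: eq_bigr => i _.
    by rewrite hN eqxx gtn_eqF // mulr0 add0r mulr1.
  apply/is_trig_mxP => i j ij; rewrite hN eqSS !gtn_eqF ?(ltnW ij) //; last exact: leqW.
  by rewrite !mulr0 addr0.
by rewrite mulrC => /(mulIf (expf_neq0 n (rp_x0 Rxy))).
Qed.

Lemma det_weight k (B : 'M[R]_k) : (forall i j, ideal2 x y (B i j)) ->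
  mon x y (weight_ge 1 1 k) (\det B).
Proof.
elim: k B => [|k IH] B hB; first by move=> i j; rewrite /weight_ge.
rewrite (expand_det_row _ 0).
apply: (@ideal_sum R _ _ _ _ _ (mon_ideal x y (weight_ge 1 1 k.+1))) => j _.
apply: (@mon_mul R x y Rxy (weight_ge 1 1 1) (weight_ge 1 1 k)).
- exact: weight_ge_up.
- exact: weight_ge_primary.
- exact: weight_ge_up.
- exact: weight_ge_primary.
- exact: weight_ge_up.
- by move=> i1 j1 i2 j2; rewrite /weight_ge; lia.
- move=> i1 j1; rewrite /weight_ge => h.
  have [-> ->] : i1 = 0%N /\ j1 = 0%N by lia.
  exact: hB.
- apply: (idealM _ (mon_ideal x y _)); apply: IH => i1 j1; rewrite !mxE; exact: hB.
Qed.

(** Cramer's rule, applied to the column of the coefficients of the form. *)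
Lemma minor_form_det (N : 'M[R]_n.+1) (l : 'I_n.+1) :
  (-1) ^+ l * (x ^+ (n - l) * y ^+ l) * \det N = \sum_i \adj N l i * minor_form (row i N).
Proof.
pose w := \col_(l < n.+1) ((-1) ^+ l * (x ^+ (n - l) * y ^+ l)).
have := mulmxA (\adj N) N w; rewrite mul_adj_mx => /matrixP /(_ l 0).
rewrite mul_scalar_mx [RHS]mxE [LHS]mxE [w _ _]mxE mulrC => <-.
apply: eq_bigr => i _; congr (_ * _); rewrite mxE; apply: eq_bigr => j _.
by rewrite !mxE.
Qed.

End MinorForm.

(** * The module as the preimage of a monomial ideal *)

Lemma strict_growth (b : nat -> nat) r i j :
  (forall k, (k < r)%N -> (b k < b k.+1)%N) ->
  (i <= j)%N -> (j <= r)%N -> (b i + (j - i) <= b j)%N.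
Proof.
move=> hb /subnKC <-; elim: (j - i)%N => [|k IH] h; first by rewrite addn0; lia.
by have := hb (i + k)%N; have := IH; rewrite addnS in h *; lia.
Qed.

Section ModulePreimage.
Variables (R : idomainType) (x y : R) (n : nat) (a b : nat -> nat).
Hypotheses (Rxy : regular_pair x y) (n0 : (0 < n)%N).
Hypotheses (a0 : (n < a 0)%N) (a1 : (n <= a 1)%N) (hb0 : b 0%N = 0%N).
Hypothesis hb : forall i, (i < n.+1)%N -> (b i < b i.+1)%N.

Local Notation M := (module_MIe x y n.+1 a b n.+1).

(** The exponents of the ideal generated by the values of the form at the f_i
    and the h_i, the index t running through f_0, f_1, h_1, ..., h_n. *)
Definition exponents (i j : nat) : Prop :=
  exists t, [/\ (t <= n.+1)%N, ((if t <= 1 then a t else n.+1 - t) <= i)%N & (b t <= j)%N].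

Lemma exponents_up : upclosed exponents.
Proof. by move=> i j k l [t [h1 h2 h3]] h4 h5; exists t; split=> //; lia. Qed.

Lemma exponents_primary : primary exponents.
Proof.
split; first by exists (a 0%N), 0%N; split=> //; rewrite hb0.
by exists (b n.+1), n.+1; split => //; case: (n) n0 => // k _; rewrite subnn.
Qed.

Lemma module_MIe_subP (N : set 'rV[R]_n.+1) : is_submod N ->
  M `<=` N <->
  [/\ N (x ^+ (a 0 - n) *: eps R n.+1 1),
      N ((x ^+ (a 1 - n) * y ^+ b 1) *: eps R n.+1 1),
      forall k, (k < n)%N -> N (geng x y n.+1 k.+1)
    & forall k, (k < n)%N -> N (y ^+ (b k.+2 - k.+1) *: eps R n.+1 k.+2)].
Proof.
move=> NI; split=> [MN|[h1 h2 h3 h4]].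
  split.
  - apply: MN; apply: lspan_incl; left; left; exists 0%N => //.
    by rewrite /genf hb0 mulr1 addn1 subSS.
  - apply: MN; apply: lspan_incl; left; left; exists 1%N; first by rewrite /= subnn.
    by rewrite /genf addn1 subSS.
  - by move=> k kn; apply: MN; apply: lspan_incl; left; right; exists k.+1 => //=; lia.
  - move=> k kn; apply: MN; apply: lspan_incl; right; exists k.+1; first by rewrite /=; lia.
    by rewrite /genh subnn.
apply: lspan_least => // u [[[i]|[[|i]]]|[[|i]]] //=.
- rewrite subnn add0n /genf addn1 subSS; case: i => [|[|i]] //= _ <-; last exact: h2.
  by rewrite hb0 mulr1.
- by move=> hi <-; apply: h3; lia.
- by move=> hi <-; rewrite /genh subnn; apply: h4; lia.
Qed.

Lemma module_MIe_submod : is_submod M. Proof. exact: lspan_submod. Qed.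

Lemma module_MIe_gens : [/\ M (x ^+ (a 0 - n) *: eps R n.+1 1),
      M ((x ^+ (a 1 - n) * y ^+ b 1) *: eps R n.+1 1),
      forall k, (k < n)%N -> M (geng x y n.+1 k.+1)
    & forall k, (k < n)%N -> M (y ^+ (b k.+2 - k.+1) *: eps R n.+1 k.+2)].
Proof. by apply/module_MIe_subP => //; exact: module_MIe_submod. Qed.

Lemma sign_ideal (J : set R) k z : is_ideal J -> J ((-1) ^+ k * z) <-> J z.
Proof.
move=> JI; split=> h; last exact: idealM.
by rewrite -(signrMK k z); apply: idealM.
Qed.

Lemma minor_form_monomial u : M u -> mon x y exponents (minor_form x y u).
Proof.
have monI := mon_ideal x y exponents; move: u; apply/(module_MIe_subP _).
  split; first by rewrite /= -[0](scale0r (0 : 'rV_n.+1)) minor_formZ mul0r; case: monI.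
  by move=> c u v; rewrite /= minor_form_linear; case: monI => _; apply.
have inE i j : exponents i j -> mon x y exponents (x ^+ i * y ^+ j).
  by move/(mon_monomial Rxy _ _ exponents_up).
split=> [||k kn|k kn] /=.
- rewrite minor_formZ minor_form_eps // subn0 mul1r mulrA -exprD subnK ?(ltnW a0) //.
  by apply: inE; exists 0%N; rewrite hb0.
- rewrite minor_formZ minor_form_eps // subn0 mul1r mulr1 mulrAC -exprD subnK //.
  by apply: inE; exists 1%N; split.
- by rewrite minor_form_geng //; case: monI.
- rewrite minor_formZ minor_form_eps // mulrCA; apply/sign_ideal => //.
  rewrite mulrCA -exprD subnK; last by have := strict_growth hb (leq0n k.+2) kn; lia.
  by apply: inE; exists k.+2; split.
Qed.

Lemma minor_form_onto z : mon x y exponents z -> exists2 u, M u & minor_form x y u = z.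
Proof.
have [g1 g2 g3 g4] := module_MIe_gens.
have [[A SA] [B SB]] := exponents_primary.
move: z; apply: (mon_least Rxy exponents_up SA SB) => [|i j [t [h1 h2 h3]]].
- split.
    exists 0; first by case: module_MIe_submod.
    by rewrite -[0](scale0r (0 : 'rV_n.+1)) minor_formZ mul0r.
  move=> c _ _ [u1 hu1 <-] [v1 hv1 <-]; exists (c *: u1 + v1); last exact: minor_form_linear.
  by case: module_MIe_submod => _; apply.
- have close w i' j' : M w -> (exists s, minor_form x y w = (-1) ^+ s * (x ^+ i' * y ^+ j')) ->
      (i' <= i)%N -> (j' <= j)%N -> exists2 v, M v & minor_form x y v = x ^+ i * y ^+ j.
    move=> Mw [s es] hi hj; exists (((-1) ^+ s * x ^+ (i - i') * y ^+ (j - j')) *: w).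
      by apply: submodZ => //; exact: module_MIe_submod.
    rewrite minor_formZ es -{2}(subnK hi) -{2}(subnK hj) !exprD.
    by rewrite -[RHS](signrMK s); ring.
  move: t h1 h2 h3 => [|[|t]] h1 h2 h3.
  + apply: (close _ (a 0%N) 0%N g1) => //; exists 0%N.
    by rewrite minor_formZ minor_form_eps // subn0 !mul1r mulrA -exprD subnK ?(ltnW a0).
  + apply: (close _ (a 1%N) (b 1%N) g2) => //; exists 0%N.
    by rewrite minor_formZ minor_form_eps // subn0 !mul1r mulr1 mulrAC -exprD subnK.
  + apply: (close _ (n.+1 - t.+2)%N (b t.+2) (g4 t _)) => //; exists t.+1.
    rewrite minor_formZ minor_form_eps // mulrCA; congr (_ * _).
    by rewrite mulrCA -exprD subnK //; have := strict_growth hb (leq0n t.+2) h1; lia.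
Qed.

(** The module contains the kernel of the form, so it is determined by its
    image. *)
Lemma module_MIe_preimage u : M u <-> mon x y exponents (minor_form x y u).
Proof.
split=> [/minor_form_monomial //|/minor_form_onto [v Mv e]].
rewrite -[u](subrK v); apply: submodD => //; first exact: module_MIe_submod.
have [_ _ g3 _] := module_MIe_gens; apply: (minor_form_ker Rxy module_MIe_submod g3).
by rewrite minor_formB e subrr.
Qed.

Lemma module_MIe_coord u l : M u -> ideal2 x y (u 0 l).
Proof.
have Jl := ideal2_ideal x y; move: u.
have inx z : ideal2 x y (x * z) by rewrite mulrC; exact: ideal2l.
have iny z : ideal2 x y (y * z) by rewrite mulrC; exact: ideal2r.
apply/(module_MIe_subP _).
  split=> [|c u v]; rewrite /= !mxE; first by case: Jl.
  by case: Jl => _; apply.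
split=> [||k kn|k kn] /=; rewrite !mxE.
- by rewrite (_ : (a 0 - n = (a 0 - n.+1).+1)%N) ?exprS -?mulrA //; lia.
- rewrite (_ : b 1 = (b 1).-1.+1) ?[y ^+ _]exprS; last by have := hb (ltn0Sn n); lia.
  by rewrite mulrCA -mulrA; exact: iny.
- exact: idealD.
- rewrite (_ : (b k.+2 - k.+1 = (b k.+2 - k.+2).+1)%N) ?exprS -?mulrA //.
  by have := strict_growth hb (leq0n k.+2) kn; lia.
Qed.

(** The exponents of the product of [exponents] and the n-th power of the maximal
    ideal. *)
Definition product_exponents (i j : nat) : Prop := exists i1 j1 i2 j2,
  [/\ exponents i1 j1, (n <= i2 + j2)%N, (i1 + i2 <= i)%N & (j1 + j2 <= j)%N].

(** By Cramer's rule this multiple of det N is a combination of the values of the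
    form at the rows of N.  The coefficients are minors of size n of a matrix with
    entries in the maximal ideal, so they lie in its n-th power. *)
Lemma minor_form_multiple_of_det (N : 'M[R]_n.+1) (l : 'I_n.+1) : (forall i, M (row i N)) ->
  mon x y product_exponents (x ^+ (n - l) * y ^+ l * \det N).
Proof.
move=> hN; apply/(sign_ideal l _ (mon_ideal x y product_exponents)).
rewrite mulrA minor_form_det.
apply: (@ideal_sum R _ _ _ _ _ (mon_ideal x y product_exponents)) => i _.
rewrite mulrC; apply: (@mon_mul R x y Rxy exponents (weight_ge 1 1 n)).
- exact: exponents_up.
- exact: exponents_primary.
- exact: weight_ge_up.
- exact: weight_ge_primary.
- move=> i1 j1 k1 l1 [i2 [j2 [i3 [j3 [h1 h2 h3 h4]]]]] h5 h6.
  by exists i2, j2, i3, j3; split => //; lia.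
- move=> i1 j1 i2 j2 h1; rewrite /weight_ge => h2.
  by exists i1, j1, i2, j2; split => //; lia.
- exact/module_MIe_preimage.
- rewrite mxE; apply: (idealM _ (mon_ideal x y _)); apply: det_weight => // i1 j1.
  by rewrite !mxE; have := module_MIe_coord (lift l j1) (hN (lift i i1)); rewrite mxE.
Qed.

Lemma module_MIe_powers : exists N, (forall u, M (x ^+ N *: u)) /\ forall u, M (y ^+ N *: u).
Proof.
have [[A SA] [B SB]] := exponents_primary.
have pow i j u : exponents i j -> M ((x ^+ i * y ^+ j) *: u).
  move=> h; apply/module_MIe_preimage; rewrite minor_formZ mulrC.
  apply: (idealM _ (mon_ideal x y _)).
  exact/mon_monomial/h/exponents_up.
exists (A + B)%N; split=> u.
  rewrite -[x ^+ _]mulr1 -[1](expr0 y); apply: pow; apply: exponents_up SA _ _; lia.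
rewrite -[y ^+ _]mul1r -[1](expr0 x); apply: pow; apply: exponents_up SB _ _; lia.
Qed.

Lemma module_MIe_double_dual : double_dual M = frac_emb [set: 'rV[R]_n.+1].
Proof.
have [N [h1 h2]] := module_MIe_powers.
exact: (double_dual_free Rxy h1 h2).
Qed.

Lemma minor_form_in_ideal u : M u -> ideal_of_module M (minor_form x y u).
Proof.
move=> Mu; rewrite -(det_bordered Rxy).
apply: (ideal_of_module_det module_MIe_submod module_MIe_double_dual) => i.
have [_ _ g _] := module_MIe_gens.
have [->|i0] := eqVneq i 0.
  rewrite (_ : row 0 _ = u) //; by apply/rowP => j; rewrite !mxE.
have ip : (0 < i)%N by rewrite lt0n.
rewrite (_ : row i _ = geng x y n.+1 i.-1.+1); first by apply: g; have := ltn_ord i; lia.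
by apply/rowP => j; rewrite [LHS]mxE mxE (negPf i0) prednK.
Qed.

(** Otherwise x^n det N would be in (x^(2n+2), y) for all N with rows in the
    module, and the whole ideal would be contained in (x^(n+2), y). *)
Lemma a0_of_ideal_of_module : ideal_of_module M (x ^+ n.+1) -> a 0%N = n.+1.
Proof.
move=> h; apply/eqP; rewrite eqn_leq a0 andbT leqNgt; apply/negP => hlt.
have : ideal2 (x ^+ n.+2) (y ^+ 1) (x ^+ n.+1).
  apply: (ideal_of_module_sub module_MIe_double_dual (ideal2_ideal _ _) _ h) => N hN.
  apply: (ideal2_cancel (k := n) Rxy); rewrite addSn.
  have := minor_form_multiple_of_det ord0 hN; rewrite subn0 mulr1; apply.
  case=> i1 [j1 [i2 [j2 [[t [h1 h2 h3]] h4 h5 h6]]]].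
  case: t h1 h2 h3 => [|t] h1 h2 h3; first by move: h2 => /=; lia.
  by have := strict_growth hb (leq0n t.+1) h1; lia.
rewrite -[x ^+ n.+1]mulr1 -[1](expr0 y) -[_ * _]mul1r.
by apply: ideal2_unit_coef => //; exact: unitr1.
Qed.

(** The value of the form at f_1 is x^n y^(b 1). *)
Lemma b1_of_ideal_of_module : a 1%N = n -> ~ ideal_of_module M (x ^+ n * y) -> (1 < b 1)%N.
Proof.
move=> e1 h; have := hb (ltn0Sn n); rewrite leq_eqVlt hb0 => /orP [/eqP e|//].
case: h; have [_ /minor_form_in_ideal h _ _] := module_MIe_gens; move: h.
by rewrite minor_formZ minor_form_eps // subn0 !mul1r mulr1 e1 subnn mul1r -e mulrC.
Qed.

(** What [exponents] becomes once a 0 = n + 1 forces a i = n + 1 - i. *)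
Definition staircase (i j : nat) : Prop :=
  exists t, [/\ (t <= n.+1)%N, (n.+1 - t <= i)%N & (b t <= j)%N].

Hypotheses (a0E : a 0%N = n.+1) (a1E : a 1%N = n).

Lemma exponentsE i j : exponents i j <-> staircase i j.
Proof.
split=> -[t [h1 h2 h3]]; exists t; split=> //; move: h2.
  by case: t {h1 h3} => [|[|t]] /=; rewrite ?a0E ?a1E; lia.
by case: t {h1 h3} => [|[|t]] /=; rewrite ?a0E ?a1E; lia.
Qed.

Lemma module_MIe_staircase u : M u <-> mon x y staircase (minor_form x y u).
Proof.
split=> [/module_MIe_preimage|] h; last apply/module_MIe_preimage.
  by apply: mon_sub h => i j /exponentsE.
by apply: mon_sub h => i j /exponentsE.
Qed.

(** One inclusion holds because the values of the form are determinants.  For the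
    other, y^n det N is in I m^n, where I is the right-hand side, and
    (I m^n : y^n) = I because b increases by at least one at each step. *)
Lemma ideal_of_moduleE : ideal_of_module M = mon x y staircase.
Proof.
apply/seteqP; split=> z.
  move=> hz; apply: (ideal_of_module_sub module_MIe_double_dual (mon_ideal _ _ _) _ hz).
  move=> N hN i j hij.
  apply: (ideal2_cancelr (k := n) Rxy); rewrite addSn.
  have := minor_form_multiple_of_det ord_max hN; rewrite subnn mul1r; apply.
  case=> i1 [j1 [i2 [j2 [/exponentsE [t [h1 h2 h3]] h4 h5 h6]]]]; apply: hij.
  (* In x-degree i the staircase starts at b (n + 1 - i). *)
  have [hi|hi] := leqP n.+1 i; first by exists 0%N; split => //; rewrite ?hb0; lia.
  exists (n.+1 - i)%N; split; [lia|lia|].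
  have ht : (n.+1 - i <= t)%N by lia.
  by have := strict_growth hb ht h1; lia.
move=> hz; have [|u Mu <-] := @minor_form_onto z; last exact: minor_form_in_ideal.
by apply: mon_sub hz => i j /exponentsE.
Qed.

End ModulePreimage.

(** * Separating an exponent from a convex staircase *)

Lemma seq_max (s : seq rat) : s != [::] ->
  exists2 c, c \in s & forall d, d \in s -> d <= c.
Proof.
elim: s => // e s IH _; case: s IH => [|f s] IH.
  by exists e => [|d]; rewrite inE ?eqxx // => /eqP ->.
have [//|c cs hc] := IH; have [h|h] := leP e c.
  by exists c => [|d]; rewrite inE ?cs ?orbT // => /orP [/eqP ->|/hc].
exists e => [|d]; rewrite inE ?eqxx // => /orP [/eqP ->|/hc hd] //.
exact: le_trans hd (ltW h).
Qed.

Lemma rat_between (s s' : seq rat) : s != [::] ->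
  (forall c d, c \in s -> d \in s' -> c < d) ->
  exists e, (forall c, c \in s -> c < e) /\ (forall d, d \in s' -> e < d).
Proof.
move=> /seq_max [c cs hc] h; case: s' h => [|d0 s'] h.
  by exists (c + 1); split=> // d /hc; lra.
have [|d' ds' hd'] := @seq_max [seq - d | d <- d0 :: s']; first by [].
move/mapP: ds' => [d ds ed]; have cd := h c d cs ds.
exists ((c + d) / 2); split=> [e /hc|e es]; first by lra.
by have := hd' (- e) (map_f _ es); rewrite ed; lra.
Qed.

(** The hypothesis says that (t, j) lies strictly below each chord from a point
    (l, b l) with l < t to a point (l', b l') with l' > t, so the slopes of the
    lines from it to the former are smaller than those to the latter.  A line
    through (t, j) with an intermediate slope p / q runs below all the points. *)
Lemma separating_weights (r t j : nat) (b : nat -> nat) :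
  (0 < t)%N -> (t <= r)%N -> b 0%N = 0%N -> (j < b t)%N ->
  (forall l l', (l < t)%N -> (t < l')%N -> (l' <= r)%N ->
     (j * (l' - l) < b l * (l' - t) + b l' * (t - l))%N) ->
  exists p q, [/\ (0 < p)%N, (0 < q)%N, coprime p q &
    forall l, (l <= r)%N -> (p * (r - t) + q * j < p * (r - l) + q * b l)%N].
Proof.
move=> t0 tr b0 jbt hconv.
pose lo (l : nat) : rat := (j%:R - (b l)%:R) / (t - l)%:R.
pose hi (l : nat) : rat := ((b l)%:R - j%:R) / (l - t)%:R.
have [||e [he1 he2]] := @rat_between [seq lo l | l <- iota 0 t] [seq hi l | l <- iota t.+1 (r - t)].
- by case: (t) t0.
- move=> _ _ /mapP [l hl ->] /mapP [l' hl' ->]; rewrite mem_iota in hl; rewrite mem_iota in hl'.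
  have lt : (l < t)%N by lia.
  have tl' : (t < l')%N by lia.
  rewrite /lo /hi ltr_pdivrMr ?ltr0n ?subn_gt0 // mulrAC ltr_pdivlMr ?ltr0n ?subn_gt0 //.
  have := hconv l l' lt tl'; have -> : (l' <= r)%N by lia.
  move=> /(_ isT); rewrite -(ltr_nat rat) natrD !natrM.
  by rewrite !natrB ?(ltnW lt) ?(ltnW tl') //; [lra|lia].
have e0 : 0 < e.
  have h : lo 0%N \in [seq lo l | l <- iota 0 t] by apply: map_f; rewrite mem_iota.
  apply: le_lt_trans (he1 _ h); rewrite /lo b0 subr0.
  by apply: mulr_ge0; rewrite ?invr_ge0; exact: ler0n.
have p0 : 0 < numq e by rewrite numq_gt0.
have q0 := denq_gt0 e.
pose p := `|numq e|%N; pose q := `|denq e|%N.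
have pp : p%:Z = numq e by rewrite /p; lia.
have qq : q%:Z = denq e by rewrite /q; lia.
have qR : 0 < q%:R :> rat by rewrite ltr0n; lia.
have eE : e = p%:R / q%:R by rewrite -[LHS]divq_num_den -pp -qq.
exists p, q; split; [lia|lia|exact: coprime_num_den|].
move=> l lr; rewrite -(ltr_nat rat) !natrD !natrM !natrB //.
have [lt|] := ltnP l t.
  have : lo l < e by apply: he1; apply: map_f; rewrite mem_iota; lia.
  rewrite /lo ltr_pdivrMr ?ltr0n ?subn_gt0 // eE mulrAC ltr_pdivlMr // natrB ?(ltnW lt) //.
  lra.
rewrite leq_eqVlt => /orP [/eqP <-|lt].
  by rewrite ltrD2l ltr_pM2l // ltr_nat.
have : e < hi l by apply: he2; apply: map_f; rewrite mem_iota; lia.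
rewrite /hi ltr_pdivlMr ?ltr0n ?subn_gt0 // eE mulrAC ltr_pdivrMr // natrB ?(ltnW lt) //.
lra.
Qed.

(** * Integral closedness *)

Section Closure.
Variables (R : idomainType) (x y : R) (n : nat) (b : nat -> nat).
Hypotheses (Rxy : regular_pair x y) (hb0 : b 0%N = 0%N).
Local Notation K := {fraction R}.
Local Notation "s %:F" := (FracField.tofrac s).
Local Notation I := (mon x y (staircase n b)).

Lemma staircase_up : upclosed (staircase n b).
Proof. by move=> i j k l [t [h1 h2 h3]] h4 h5; exists t; split=> //; lia. Qed.

Lemma corner_in t : (t <= n.+1)%N -> I (x ^+ (n.+1 - t) * y ^+ b t).
Proof. by move=> h; apply/(mon_monomial Rxy _ _ staircase_up); exists t. Qed.

Lemma ideal_powM (J : set R) k c (u : 'I_k -> R) : (forall i, J (u i)) ->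
  ideal_pow J k (c * \prod_(i < k) u i).
Proof.
move=> hu; apply/ideal_genP => J' J'I XJ'; apply: idealM => //; apply: XJ'.
by exists u.
Qed.

(** The integral equation is T^k - z^k = 0, with z^k in J^k. *)
Lemma root_integral (J : set R) k z : (0 < k)%N -> ideal_pow J k (z ^+ k) ->
  integral_over_ideal J z.
Proof.
move=> k0 hz; have powI i : is_ideal (ideal_pow J i).
  split; first by apply/ideal_genP => J' [].
  move=> c u v /ideal_genP hu /ideal_genP hv; apply/ideal_genP => J' J'I XJ'.
  by case: (J'I) => _; apply; [exact: hu|exact: hv].
exists k, (fun i => if i == k then - z ^+ k else 0); split => //.
  move=> i _; case: eqP => [->|_]; last by case: (powI i).
  by rewrite -mulN1r; apply: idealM.
rewrite big_nat_recr //= eqxx subnn mulr1 big_nat big1 ?add0r ?subrr //.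
by move=> i /andP [_ ik]; rewrite ltn_eqF // mul0r.
Qed.

Hypothesis Icomplete : complete_ideal I.

(** If the inequality failed, the power l' - l of x^(n+1-t) y^j would be divisible
    by the product of l' - t copies of the corner monomial of index l and t - l
    copies of the one of index l'.  So x^(n+1-t) y^j would be integral over I. *)
Lemma complete_staircase_convex t j l l' : (t <= n.+1)%N -> ~ staircase n b (n.+1 - t) j ->
  (l < t)%N -> (t < l')%N -> (l' <= n.+1)%N ->
  (j * (l' - l) < b l * (l' - t) + b l' * (t - l))%N.
Proof.
move=> tn hj lt tl' l'n; rewrite ltnNge; apply/negP => h; apply: hj.
apply/(mon_monomial Rxy _ _ staircase_up); apply: Icomplete.
apply: (@root_integral _ (l' - l)); first by lia.
(* The l' - t copies of the corner l, then the t - l copies of the corner l'. *)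
pose u (i : 'I_(l' - l)) := if (i < l' - t)%N then x ^+ (n.+1 - l) * y ^+ b l
  else x ^+ (n.+1 - l') * y ^+ b l'.
have -> : (x ^+ (n.+1 - t) * y ^+ j) ^+ (l' - l) =
    y ^+ (j * (l' - l) - (b l * (l' - t) + b l' * (t - l))) * \prod_i u i.
  have -> : \prod_i u i = (x ^+ (n.+1 - l) * y ^+ b l) ^+ (l' - t) *
     (x ^+ (n.+1 - l') * y ^+ b l') ^+ (t - l).
    pose f i := if (i < l' - t)%N then x ^+ (n.+1 - l) * y ^+ b l else x ^+ (n.+1 - l') * y ^+ b l'.
    rewrite -(big_mkord xpredT f) (@big_cat_nat _ _ _ (l' - t)) //=; last by lia.
    rewrite big_nat (eq_bigr (fun=> x ^+ (n.+1 - l) * y ^+ b l)); last first.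
      by move=> i /andP [_ hi]; rewrite /f hi.
    rewrite -big_nat prodr_const_nat subn0; congr (_ * _).
    rewrite big_nat (eq_bigr (fun=> x ^+ (n.+1 - l') * y ^+ b l')); last first.
      by move=> i /andP [hi _]; rewrite /f ltnNge hi.
    by rewrite -big_nat prodr_const_nat; congr (_ ^+ _); lia.
  have ex : ((n.+1 - t) * (l' - l) = (n.+1 - l) * (l' - t) + (n.+1 - l') * (t - l))%N.
    by rewrite -[n.+1](subnK l'n); nia.
  rewrite !exprMn -!exprM ex exprD -{1}(subnK h) !exprD; ring.
apply: ideal_powM => i; rewrite /u; case: ifP => _; apply: corner_in; lia.
Qed.

(** If z is not in I, the membership fails at an exponent (i, j) outside the
    staircase.  Weights p and q separating (i, j) from the staircase give a
    valuation whose value is larger than p i + q j on I, but not at z. *)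
Lemma valuative_criterion z :
  (forall V, dvr V -> @fracR R `<=` V -> lspan V ([set s%:F | s in I] : set K^o) z%:F) -> I z.
Proof.
move=> hz i j hij; have [hi|hi] := leqP n.+1 i.
  by case: hij; exists 0%N; split; rewrite ?hb0 //; lia.
pose t := (n.+1 - i)%N.
have it : i = (n.+1 - t)%N by rewrite /t; lia.
have tn : (t <= n.+1)%N by rewrite /t; lia.
have t0 : (0 < t)%N by rewrite /t; lia.
have hij' : ~ staircase n b (n.+1 - t) j by rewrite -it.
have jt : (j < b t)%N by rewrite ltnNge; apply/negP => h; apply: hij'; exists t.
have [p [q [p0 q0 pq hpq]]] := separating_weights t0 tn hb0 jt
  (fun l l' => @complete_staircase_convex t j l l' tn hij').
have [v vv hv] := monomial_valuation Rxy p0 q0 pq.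
pose N := (p * i + q * j).+1.
suff : mon x y (weight_ge p q N) z by apply; rewrite /weight_ge /N; lia.
have IN s : I s -> mon x y (weight_ge p q N) s.
  apply: mon_sub => k l [t' [h1 h2 h3]]; have := hpq t' h1.
  by rewrite -it /weight_ge /N; nia.
have [||k [c [u [hc hu e]]]] := hz (valuation_ge v 0).
- by exists v.
- by move=> _ [s _ <-]; apply: (hv 0%N s).1 => k l [].
apply/hv; rewrite e; elim/big_ind: _ => [|w w'|i' _]; first by left.
  exact: valuation_geD.
have [s /IN /hv hs <-] := hu i'; rewrite -[N%:Z]add0r.
exact: (valuation_geM vv (hc i') hs).
Qed.

(** The coordinates of an element of the closure are in R by [regular_normal], and
    the form, being linear, carries M V into I V. *)
Lemma integrally_closed_preimage (M : set 'rV[R]_n.+1) :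
  (forall u, M u <-> I (minor_form x y u)) -> integrally_closed M.
Proof.
move=> hM; apply/seteqP; split => [f [_ hf]|_ [u Mu <-]]; last first.
  split; first by apply: lspan_incl; exists u.
  move=> V _ RV; exists 1%N, (fun=> 1), (fun=> map_mx (fun s => s%:F) u).
  split; [|by move=> _; exists u|by rewrite big_ord1 scale1r].
  by move=> _; apply: RV; exists 1; rewrite ?tofrac1.
have /choice [F hF] : forall l, exists s : R, s%:F = f 0 l.
  move=> l; have [s _ es] : fracR (f 0 l); last by exists s.
  apply: (regular_normal Rxy) => V hV RV; have [k [c [u [hc hu ->]]]] := hf V hV RV.
  rewrite summxE; case: hV RV hc => v vv -> RV hc.
  elim/big_ind: _ => [|w w'|i _]; [by left|exact: (valuation_geD vv)|].
  have [w _ <-] := hu i; rewrite !mxE.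
  have hw : valuation_ge v 0 (w 0 l)%:F by apply: RV; exists (w 0 l).
  by have := valuation_geM vv (hc i) hw; rewrite addr0.
pose u := \row_l F l.
have fE : f = map_mx (fun s => s%:F) u by apply/rowP => l; rewrite !mxE hF.
exists u => //; apply/hM; apply: valuative_criterion => V hV RV.
have [k [c [w [hc hw e]]]] := hf V hV RV.
have /choice [w' hw'] : forall i, exists w', M w' /\ map_mx (fun s => s%:F) w' = w i.
  by move=> i; have [w' Mw' ew] := hw i; exists w'.
exists k, c, (fun i => (minor_form x y (w' i))%:F); split=> //.
  by move=> i; exists (minor_form x y (w' i)) => //; exact: (hM (w' i)).1 (hw' i).1.
pose ph (g : 'rV[K]_n.+1) : K := \sum_l g 0 l * ((-1) ^+ l * (x ^+ (n - l) * y ^+ l))%:F.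
have phE g : (minor_form x y g)%:F = ph (map_mx (fun s => s%:F) g).
  rewrite /minor_form /ph (big_morph _ (@tofracD R) (tofrac0 R)); apply: eq_bigr => l _.
  by rewrite mxE tofracM.
rewrite phE -fE e /ph; under eq_bigr => l _ do rewrite summxE mulr_suml.
rewrite exchange_big; apply: eq_bigr => i _ /=; rewrite phE /ph scaler_sumr.
by apply: eq_bigr => l _; case: (hw' i) => _ ->; rewrite mxE -mulrA.
Qed.

End Closure.

(** * Indecomposability *)

Section Indecomposability.
Variables (R : idomainType) (x y : R) (n : nat).
Hypothesis Rxy : regular_pair x y.

(** Over the residue field the matrix is lower triangular with nonzero diagonal
    entries. *)
Lemma det_lower_unit k (B : 'M[R]_k) :
  (forall i j : 'I_k, (i < j)%N -> ideal2 x y (B i j)) ->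
  (forall i, ~ ideal2 x y (B i i)) -> B \in unitmx.
Proof.
rewrite unitmxE => hup hdiag; apply: (rp_unit Rxy).
elim: k B hup hdiag => [|k IH] B hup hdiag; first by rewrite det_mx00; exact: (rp_proper Rxy).
rewrite (expand_det_row _ 0) big_ord_recl => h.
have hm : ~ ideal2 x y (\det (row' 0 (col' 0 B))).
  apply: IH => [i j ij|i]; rewrite !mxE; [by apply: hup; rewrite !lift0|exact: hdiag].
have : ideal2 x y (B 0 0 * cofactor B 0 0).
  rewrite -[_ * _](addrK (\sum_(i < k) B 0 (lift ord0 i) * cofactor B 0 (lift ord0 i))).
  apply: (idealB (ideal2_ideal x y)) => //.
  apply: (@ideal_sum R _ _ _ _ _ (ideal2_ideal x y)) => j _; rewrite mulrC.
  by apply: (idealM _ (ideal2_ideal x y)); apply: hup; rewrite lift0.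
rewrite /cofactor expr0 mul1r; apply: (nonunit (rp_proper Rxy)).
by rewrite unitrM (rp_unit Rxy (hdiag 0)) (rp_unit Rxy hm).
Qed.

(** The exponents of (x^(n+1)) + m^(n+2). *)
Definition above_diagonal (i j : nat) : Prop := (n < i)%N \/ (n.+1 < i + j)%N.

(** Up to sign, u 0 l - v 0 k is the coefficient of x^(n+1-l) y^l in degree
    n + 1. *)
Lemma above_diagonal_coef u v (k l : 'I_n.+1) : l = k.+1 :> nat ->
  mon x y above_diagonal (x * minor_form x y u + y * minor_form x y v) ->
  ideal2 x y (u 0 l - v 0 k).
Proof.
move=> lk /(_ (n - k)%N l) h; have ln := ltn_ord l.
have {}h := h ltac:(rewrite /above_diagonal; lia).
have J := ideal2_ideal (x ^+ (n - k).+1) (y ^+ l.+1).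
have key i j c : ~ (i = (n - k)%N /\ j = l :> nat) -> (i + j = n.+1)%N ->
    ideal2 (x ^+ (n - k).+1) (y ^+ l.+1) (c * (x ^+ i * y ^+ j)).
  by move=> ne e; apply: idealM => //; apply: ideal2_monomial; lia.
apply/(sign_ideal l _ (ideal2_ideal x y)).
apply: (ideal2_coef (a := n - k) (b := l) Rxy).
have hu : ideal2 (x ^+ (n - k).+1) (y ^+ l.+1)
    (\sum_(i | i != l) x * (u 0 i * ((-1) ^+ i * (x ^+ (n - i) * y ^+ i)))).
  apply: (@ideal_sum R _ _ _ _ _ J) => i il.
  rewrite (_ : _ * _ = (u 0 i * (-1) ^+ i) * (x ^+ (n - i).+1 * y ^+ i)); last first.
    by rewrite exprS; ring.
  apply: key; last by have := ltn_ord i; lia.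
  by case=> _ e; case/eqP: il; exact: val_inj.
have hv : ideal2 (x ^+ (n - k).+1) (y ^+ l.+1)
    (\sum_(i | i != k) y * (v 0 i * ((-1) ^+ i * (x ^+ (n - i) * y ^+ i)))).
  apply: (@ideal_sum R _ _ _ _ _ J) => i ik.
  rewrite (_ : _ * _ = (v 0 i * (-1) ^+ i) * (x ^+ (n - i) * y ^+ i.+1)); last first.
    by rewrite exprS; ring.
  apply: key; last by have := ltn_ord i; lia.
  by case=> _ e; case/eqP: ik; apply: val_inj; rewrite /= in e *; lia.
move: h; rewrite /minor_form !mulr_sumr (bigD1 l) //= [X in _ + X](bigD1 k) //= => h.
have := idealB J (idealB J h hu) hv; congr (ideal2 _ _ _).
have -> : (n - l = n - k - 1)%N by lia.
have -> : (n - k = (n - k - 1).+1)%N by lia.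
rewrite lk subSS subn0 !exprS; ring.
Qed.

Variable M : set 'rV[R]_n.+1.
Hypotheses
  (Mform : forall u, M u -> mon x y above_diagonal (minor_form x y u))
  (M0 : M (x *: eps R n.+1 1))
  (Mg : forall k, (k < n)%N -> M (geng x y n.+1 k.+1))
  (Mpow : exists N, (forall u, M (x ^+ N *: u)) /\ forall u, M (y ^+ N *: u)).

Lemma row_eps (k : nat) (kn : (k < n.+1)%N) (P : 'M[R]_n.+1) :
  eps R n.+1 k.+1 *m P = row (Ordinal kn) P.
Proof.
rewrite rowE; congr (_ *m _); apply/rowP => j; rewrite !mxE eqxx /= eqSS.
by [].
Qed.

(** The image of x eps_1 has the form x (row 0 of P), and the image of g_(i+1) has
    the form y (row i of P) + x (row i + 1 of P).  As they are in M,
    [above_diagonal_coef] shows that modulo the maximal ideal the row 0 vanishes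
    outside the diagonal, and that P is constant along the diagonals. *)
Lemma endomorphism_lower_triangular (P : 'M[R]_n.+1) : (forall u, M u -> M (u *m P)) ->
  (forall i j : 'I_n.+1, (i < j)%N -> ideal2 x y (P i j)) /\
  (forall i, ideal2 x y (P i i - P 0 0)).
Proof.
move=> MP; have J := ideal2_ideal x y.
have top (l : 'I_n.+1) : (0 < l)%N -> ideal2 x y (P 0 l).
  move=> l0; have kn : (l.-1 < n.+1)%N by have := ltn_ord l; lia.
  have := @above_diagonal_coef (row 0 P) 0 (Ordinal kn) l.
  rewrite /= prednK // => /(_ erefl); rewrite !mxE subr0; apply.
  rewrite [minor_form _ _ 0](_ : _ = 0) ?mulr0 ?addr0; last first.
    by rewrite -[0](scale0r (0 : 'rV_n.+1)) minor_formZ mul0r.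
  have := Mform (MP _ M0); rewrite -scalemxAl minor_formZ (row_eps (ltn0Sn n)).
  by rewrite (_ : Ordinal _ = 0) //; exact: val_inj.
have step (i j : 'I_n.+1) (i' j' : 'I_n.+1) : i' = i.+1 :> nat -> j' = j.+1 :> nat ->
    ideal2 x y (P i' j' - P i j).
  move=> ei ej; have iln : (i < n)%N by rewrite -ltnS -ei.
  have := @above_diagonal_coef (row i' P) (row i P) j j' ej; rewrite !mxE; apply.
  have i'n : (i.+1 < n.+1)%N by [].
  have := Mform (MP _ (Mg iln)); rewrite /geng mulmxDl -!scalemxAl minor_formD !minor_formZ.
  rewrite (row_eps (ltn_ord i)) (row_eps i'n) addrC.
  have -> : Ordinal i'n = i' by exact: val_inj.
  by have -> : Ordinal (ltn_ord i) = i by exact: val_inj.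
suff H (k : nat) (i j : 'I_n.+1) : i = k :> nat ->
    ((i < j)%N -> ideal2 x y (P i j)) /\ (i = j -> ideal2 x y (P i j - P 0 0)).
  by split=> [i j|i]; [exact: (H i i j erefl).1|exact: (H i i i erefl).2].
elim: k i j => [|k IH] i j ik.
  have -> : i = 0 by exact: val_inj.
  split=> [|<-]; first exact: top.
  by rewrite subrr; case: J.
have kn : (k < n.+1)%N by have := ltn_ord i; lia.
have jn : (j.-1 < n.+1)%N by have := ltn_ord j; lia.
have [h1 h2] := IH (Ordinal kn) (Ordinal jn) erefl.
split=> [ij|ij].
  have := step (Ordinal kn) (Ordinal jn) i j ik; rewrite /= prednK; last by lia.
  move=> /(_ erefl) hs; rewrite -[P i j](subrK (P (Ordinal kn) (Ordinal jn))).
  by apply: idealD => //; apply: h1 => /=; lia.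
have j0 : (0 < j)%N by rewrite -ij ik.
have := step (Ordinal kn) (Ordinal jn) i j ik; rewrite /= prednK //.
move=> /(_ erefl) hs.
rewrite (_ : _ - _ = (P i j - P (Ordinal kn) (Ordinal jn)) +
                     (P (Ordinal kn) (Ordinal jn) - P 0 0)); last by ring.
apply: idealD => //; apply: h2; apply: val_inj => /=; by rewrite -ij ik.
Qed.

(** The components in A of x^N eps and y^N eps are proportional with ratio
    x^N : y^N, so that the former is divisible by x^N.  The projection onto A
    therefore extends from M to F, and is given by a matrix over R. *)
Lemma projection_matrix (A B : set 'rV[R]_n.+1) : is_submod A -> is_submod B ->
  M = [set u + v | u in A & v in B] -> A `&` B = [set 0] ->
  exists P : 'M[R]_n.+1, [/\ P *m P = P, forall u, M u -> M (u *m P),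
    forall u, A u -> u *m P = u & forall u, B u -> u *m P = 0].
Proof.
move=> AI BI MAB AB; have [N [MxN MyN]] := Mpow.
have xN0 := expf_neq0 N (rp_x0 Rxy).
have scaleI (u v : 'rV[R]_n.+1) : x ^+ N *: u = x ^+ N *: v -> u = v.
  by move=> /rowP h; apply/rowP => j; have := h j; rewrite !mxE => /(mulfI xN0).
have ABE u : A u -> B u -> u = 0.
  by move=> hA hB; have : (A `&` B) u by []; rewrite AB.
have split_M u : M u -> exists a c, [/\ A a, B c & u = a + c].
  by rewrite {1}MAB => -[a Aa [c Bc <-]]; exists a, c.
have /choice [p hp] (l : 'I_n.+1) : exists p : 'rV[R]_n.+1,
    A (x ^+ N *: p) /\ B (x ^+ N *: (delta_mx 0 l - p)).
  have [a [c [Aa Bc e]]] := split_M _ (MxN (delta_mx 0 l)).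
  have [a' [c' [Aa' Bc' e']]] := split_M _ (MyN (delta_mx 0 l)).
  have eq : y ^+ N *: a = x ^+ N *: a'.
    apply/eqP; rewrite -subr_eq0; apply/eqP; apply: ABE.
      by apply: submodB => //; apply: submodZ.
    rewrite (_ : _ - _ = x ^+ N *: c' - y ^+ N *: c).
      by apply: submodB => //; apply: submodZ.
    apply/eqP; rewrite subr_eq addrAC eq_sym subr_eq -!scalerDr [c' + _]addrC -e' -e.
    by rewrite !scalerA mulrC.
  have /choice [p hp] j : exists s, a 0 j = s * x ^+ N.
    have [|s es] := @regular_powers R x y N N (a' 0 j) (a 0 j) Rxy; last by exists s.
    by have /rowP /(_ j) := eq; rewrite !mxE.
  have ea : a = x ^+ N *: \row_j p j by apply/rowP => j; rewrite !mxE hp mulrC.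
  exists (\row_j p j); rewrite -ea; split => //.
  by rewrite scalerBr -ea e addrAC subrr add0r.
pose P := \matrix_(l, j) p l 0 j : 'M[R]_n.+1.
have rowP' l : row l P = p l by apply/rowP => j; rewrite !mxE.
have hA u : A (x ^+ N *: (u *m P)).
  rewrite mulmx_sum_row scaler_sumr; apply: submod_sum => // l _.
  by rewrite scalerA mulrC -scalerA rowP'; apply: submodZ => //; case: (hp l).
have hB u : B (x ^+ N *: (u - u *m P)).
  rewrite {1}[u]row_sum_delta mulmx_sum_row -sumrB scaler_sumr; apply: submod_sum => // l _.
  rewrite -scalerBr scalerA mulrC -scalerA rowP'.
  by apply: submodZ => //; case: (hp l).
have projE a c : A a -> B c -> (a + c) *m P = a.
  move=> Aa Bc; apply: scaleI; apply/eqP; rewrite -subr_eq0; apply/eqP; apply: ABE.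
    by apply: submodB => //; exact: submodZ.
  rewrite (_ : _ - _ = x ^+ N *: c - x ^+ N *: ((a + c) - (a + c) *m P)).
    by apply: submodB => //; exact: submodZ.
  by rewrite -!scalerBr; congr (_ *: _); rewrite opprB addrCA opprD [- a - c]addrC addNKr.
have A0 : A 0 by case: AI.
have B0 : B 0 by case: BI.
have projA a : A a -> a *m P = a by move=> Aa; rewrite -{1}[a]addr0 projE.
exists P; split => //.
- apply/row_matrixP => l; rewrite row_mul rowP'; apply: scaleI.
  by rewrite scalemxAl projA //; case: (hp l).
- move=> u /split_M [a [c [Aa Bc ->]]]; rewrite projE // MAB.
  by exists a => //; exists 0 => //; rewrite addr0.
- by move=> c Bc; rewrite -[c]add0r projE.
Qed.

(** The common diagonal entry of the projection P is idempotent modulo the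
    maximal ideal.  If it is 0 there, 1 - P is invertible by [det_lower_unit] and
    kills P; if it is 1, P is invertible and kills B. *)
Lemma indecomposable_of_minor_form : indecomposable M.
Proof.
have J := ideal2_ideal x y; have one := rp_proper Rxy; split.
  move=> e; have : [set 0] (x *: eps R n.+1 1) by rewrite -e.
  move=> /= /rowP /(_ 0); rewrite !mxE eqxx mulr1 => /eqP; apply/negP; exact: rp_x0 Rxy.
move=> A B /submod_closedP AI /submod_closedP BI MAB AB.
have [P [PP MP PA PB]] := projection_matrix AI BI MAB AB.
have [Pup Pdiag] := endomorphism_lower_triangular MP.
have idem : ideal2 x y (P 0 0 * (1 - P 0 0)).
  have := congr1 (fun Q : 'M_n.+1 => Q 0 0) PP; rewrite mxE big_ord_recl => e.
  rewrite (_ : _ * _ = \sum_(i < n) P 0 (lift ord0 i) * P (lift ord0 i) 0).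
    apply: (@ideal_sum R _ _ _ _ _ J) => j _; rewrite mulrC.
    by apply: idealM => //; apply: Pup; rewrite lift0.
  by rewrite mulrBr mulr1 -{1}e addrAC subrr add0r.
have triv (C : set 'rV[R]_n.+1) : is_submod C -> (forall u, C u -> u = 0) -> C = [set 0].
  by move=> [C0 _] h; apply/seteqP; split=> [u /h|u ->].
have [hc|hc] := pselect (ideal2 x y (P 0 0)).
  left; apply: triv => // a Aa; suff P0 : P = 0 by rewrite -(PA a Aa) P0 mulmx0.
  have unitP : 1%:M - P \in unitmx.
    apply: det_lower_unit => [i j ij|i h].
      rewrite !mxE (negPf (_ : i != j)) ?sub0r.
        by rewrite -mulN1r; apply: idealM => //; exact: Pup.
      by rewrite -val_eqE ltn_eqF.
    apply: one; rewrite (_ : 1 = (1%:M - P) i i + ((P i i - P 0 0) + P 0 0)).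
      by apply: idealD => //; apply: idealD.
    by rewrite !mxE eqxx mulr1n; ring.
  by rewrite -(mulKmx unitP P) mulmxBl mul1mx PP subrr mulmx0.
right; apply: triv => // c Bc.
have unitP : P \in unitmx.
  apply: det_lower_unit => // i h; apply: hc.
  rewrite (_ : P 0 0 = P i i - (P i i - P 0 0)); last by ring.
  exact: idealB.
by rewrite -(mulmxK unitP c) (PB c Bc) mul0mx.
Qed.

End Indecomposability.

(** * The theorem *)

Theorem theorem5p4 (R : idomainType) (m : set R) (x y : R)
    (hreg : regular_local2 m x y)
    (hres : infinite_set (cosets m))
    (r : nat) (a b : nat -> nat)
    (hr : (2 <= r)%N)
    (ha : forall i, (i < r)%N -> (a i.+1 < a i)%N)
    (har : a r = 0%N)
    (hb0 : b 0%N = 0%N)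
    (hb : forall i, (i < r)%N -> (b i < b i.+1)%N)
    (hab : (a 0%N <= b r)%N)
    (hcomplete : complete_ideal (ideal_of_module (module_MIe x y r a b r)))
    (hnotin : ~ ideal_of_module (module_MIe x y r a b r) (x ^+ r.-1 * y))
    (hin : ideal_of_module (module_MIe x y r a b r) (x ^+ r)) :
  indecomposable (module_MIe x y r a b r) /\
  integrally_closed (module_MIe x y r a b r).
Proof.
have Rxy := regular_local2_pair hreg.
case: r hr ha har hb hab hcomplete hnotin hin => // n n0 ha har hb _ hcomplete hnotin hin.
have a_ge k : (k <= n.+1)%N -> (k <= a (n.+1 - k))%N.
  elim: k => [|k IH] // kn; have := IH (ltnW kn).
  have := ha (n.+1 - k.+1)%N; rewrite (_ : (n.+1 - k.+1).+1 = n.+1 - k)%N; lia.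
have a0 : (n < a 0)%N by have := a_ge n.+1 (leqnn _); rewrite subnn.
have a1 : (n <= a 1)%N by have := a_ge n (leqnSn _); rewrite subSnn.
have a0E := a0_of_ideal_of_module Rxy n0 a0 a1 hb0 hb hin.
have a1E : a 1%N = n by have := ha 0%N isT; lia.
have b1 := b1_of_ideal_of_module Rxy n0 a0 a1 hb0 hb a1E hnotin.
have IE := ideal_of_moduleE Rxy n0 a0 a1 hb0 hb a0E a1E.
have Mstair := module_MIe_staircase Rxy n0 a0 a1 hb0 hb a0E a1E.
have [g1 _ g3 _] := module_MIe_gens x y n0 a0 a1 hb0.
split; last first.
  by apply: (integrally_closed_preimage Rxy hb0 _ Mstair); rewrite -IE.
apply: (indecomposable_of_minor_form Rxy) => //.
- move=> u /Mstair; apply: mon_sub => i j [t [h1 h2 h3]].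
  case: t h1 h2 h3 => [|t] h1 h2 h3; first by left; lia.
  by right; have := strict_growth hb (ltn0Sn t) h1; lia.
- by move: g1; rewrite a0E subSnn.
- exact: module_MIe_powers.
Qed.
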